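(* Let $(E,C)$ be a separated graph. Then the inverse semigroup $\mathcal S(E,C)$ is isomorphic to the inverse semigroup consisting of all Munn $(E,C)$-trees, together with a zero element $0$, endowed with the product $$(T_1,g_1)\cdot (T_2,g_2)=\begin{cases}\big((T_1'\cup g_1\cdot T_2')_0,\; g_1\cdot g_2\big) & \text{if } T_1'\cup g_1\cdot T_2' \text{ is } C\text{-compatible},\\ 0 & \text{otherwise,}\end{cases}$$ where $T_1',T_2'\in\mathcal X$ are representatives of $T_1$ and $T_2$ respectively such that $g_1\in T_1'$ and $g_2\in T_2'$. The inverse is given by $(T,g)^{-1}=((g^{-1}\cdot T')_0,\,g^{-1})$, where $T'$ is a representative of $T$ such that $g\in T'$. The map $(T,g)\mapsto\omega(g)$ provides an idempotent pure partial homomorphism $\mathcal S(E,C)^\times\to\mathbb F$, which determines a semidirect product decomposition $$\mathcal S(E,C)\cong\mathcal Y\rtimes_\theta^r\mathbb F .$$ For each $v\in E^0$ and $g\in\mathbb F_C(v)\setminus\{v\}$, the ideal $D_g$ of $\mathcal Y$ can be identified with the set of all those $T\in\mathcal X_0(v)$ such that $g_0\in T$, together with $0$, and the action $\theta_g\colon D_{g^{-1}}\to D_g$ is given on nonzero elements by $\theta_g(T)=(g\cdot T')_0$, where $T'$ is a representative of $T$ containing $g^{-1}$.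
   Context: Separated graphs. A directed graph $E=(E^0,E^1,s,r)$ consists of sets $E^0$ (vertices) and $E^1$ (edges), of arbitrary cardinality, and maps $s,r\colon E^1\to E^0$. A separated graph $(E,C)$ is a directed graph $E$ with $C=\bigsqcup_{v\in E^0}C_v$, where $C_v$ is a partition of $s^{-1}(v)$ into pairwise disjoint nonempty subsets ($C_v=\emptyset$ if $s^{-1}(v)=\emptyset$). Let $E^{-1}=\{e^{-1}:e\in E^1\}$ be a set of formal inverses, $\hat E^1=E^1\sqcup E^{-1}$, $s(e^{-1})=r(e)$, $r(e^{-1})=s(e)$, $(e^{-1})^{-1}=e$. $\mathcal S(E,C)$ is the universal inverse semigroup with zero generated by $E^0\cup\hat E^1$ subject to: (1) $vw=\delta_{v,w}v$ for $v,w\in E^0$; (2) $s(x)x=x$ and (3) $xr(x)=x$ for $x\in\hat E^1$; (4) $e^{-1}f=\delta_{e,f}r(e)$ for $e,f\in X$, $X\in C$. $S^\times=S\setminus\{0\}$. Paths. A path is a vertex or a word $y_1\cdots y_n$ with $y_i\in\hat E^1$, $r(y_i)=s(y_{i+1})$; it is reduced if it contains no subword $xx^{-1}$, $x\in\hat E^1$; $\mathrm{red}(\gamma)$ is the reduction of $\gamma$ via $xx^{-1}\to s(x)$. The fundamental groupoid $\mathfrak F_{gr}(E)$ is the set of reduced paths with partial product $g\cdot h=\mathrm{red}(gh)$ when $r(g)=s(h)$. $\mathbb F=\mathbb F(E^1)$ is the free group on $E^1$, and $\omega\colon\mathfrak F_{gr}(E)\to\mathbb F$ is the canonical map (vertices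 go to $1$, a nontrivial reduced path goes to the corresponding reduced word); nontrivial reduced paths are identified with their images under $\omega$. $\mathbb F_C$ is the set of $C$-separated paths: reduced paths (vertices included) with no subword $x^{-1}y$ with $x,y\in X$, $X\in C$; $\mathbb F_C(v)=\{w\in\mathbb F_C:s(w)=v\}$. The prefix order is $\mu\le_p\nu$ iff $\mu$ is an initial segment of $\nu$. Vertices count as paths not ending in $E^{-1}$. Each $g\in\mathfrak F_{gr}(E)$ is uniquely $g=g_0w$ (as a reduced product), where $g_0$ does not end in $E^{-1}$ and $w$ is a (possibly empty) product of elements of $E^{-1}$. $C$-compatibility. $\gamma,\nu\in\mathbb F_C(v)\setminus\{v\}$ are $C$-compatible if $\mathrm{red}(\nu^{-1}\gamma)\in\mathbb F_C$; $v$ is $C$-compatible with every element of $\mathbb F_C(v)$. A subset of $\mathbb F_C(v)$ is $C$-compatible if its elements are pairwise $C$-compatible. (A set which is not contained in some $\mathbb F_C(v)$ is not $C$-compatible; in particular the product above is $0$ if $r(g_1)\neq s(g_2)$.) The semilattices. $\mathcal X(v)$ is the set of nonempty finite $C$-compatible subsets of $\mathbb F_C(v)$ that are lower sets for $\le_p$; $\mathcal X=\bigsqcup_v\mathcal X(v)\sqcup\{0\}$ is a semilattice with $A\wedge B=A\cup B$ if $A,B\in\mathcal X(v)$ for some $v$ and $A\cup B$ is $C$-compatible, and $A\wedge B=0$ otherwise. $g^\downarrow$ is the set of prefixes of $g$. $\mathcal Y=\mathcal X/{\sim}$, where $\sim$ is the congruence generated by $g^\downarrow\sim(gx^{-1})^\downarrow$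 for $g\in\mathbb F_C$, $x\in E^1$ with $r(g)=r(x)$ and $gx^{-1}$ reduced. For a nonempty finite lower set $I$, $I_0$ denotes the lower set generated by $\{g_0:g\in I\}$. Each nonzero class of $\mathcal Y$ contains exactly one $I$ with $I=I_0$; $\mathcal X_0(v)$ is the set of $I\in\mathcal X(v)$ with $I=I_0$ (i.e. no maximal element of $I$ ends in $E^{-1}$). A representative of $T\in\mathcal X_0(v)$ is a $T'\in\mathcal X(v)$ with $(T')_0=T$. A Munn $(E,C)$-tree is a pair $(T,g)$ with $T\in\mathcal X_0(v)$ and $g=g_0w\in\mathbb F_C(v)$ with $g_0\in T$, for some $v\in E^0$. For a set $T$ of reduced paths starting at $r(g)$, $g\cdot T=\{g\cdot t:t\in T\}$. Partial homomorphisms and semidirect products. For an inverse semigroup $S$ with zero and a group $\Gamma$, a partial homomorphism is a map $\pi\colon S^\times\to\Gamma$ with $\pi(st)=\pi(s)\pi(t)$ whenever $st\ne0$; it is idempotent pure if $\pi^{-1}(1)$ is the set of nonzero idempotents. If $\Gamma$ acts partially on a semilattice $\mathcal E$ with zero by isomorphisms $\theta_g\colon D_{g^{-1}}\to D_g$ between ideals, $\mathcal E\rtimes_\theta\Gamma=\{e\delta_g:e\in D_g\}$ with product $(e\delta_g)(f\delta_h)=\theta_g(\theta_g^{-1}(e)f)\delta_{gh}$ and inverse $(e\delta_g)^{-1}=\theta_g^{-1}(e)\delta_{g^{-1}}$, and $\mathcal E\rtimes^r_\theta\Gamma$ is its Rees quotient in which all $0\delta_g$ are identified with $0$. An idempotent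 pure partial homomorphism $\pi\colon S^\times\to\Gamma$ determines a partial action on the idempotents of $S$ with $D_g=\{ss^{-1}:s\in S^\times,\pi(s)=g\}\cup\{0\}$, $\theta_g(s^{-1}s)=ss^{-1}$ for $\pi(s)=g$, and an isomorphism $\mathcal E\rtimes^r_\theta\Gamma\to S$, $e\delta_g\mapsto s$ where $e=ss^{-1}$, $\pi(s)=g$. *)

(* Defs.v *)
From HB Require Import structures.
From mathcomp Require Import all_boot.
From mathcomp Require Import boolp classical_sets functions cardinality.

Set Implicit Arguments.
Unset Strict Implicit.
Unset Printing Implicit Defensive.

Local Open Scope classical_set_scope.
Local Open Scope quotient_scope.

Section Quotient.
Variables (T : Type) (R : T -> T -> Prop).
Hypotheses (Rrefl : forall x, R x x) (Rsym : forall x y, R x y -> R y x)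
  (Rtrans : forall x y z, R x y -> R y z -> R x z).

Definition asbool_equiv : equiv_rel T.
Proof.
refine (@EquivRelPack T (fun x y => `[< R x y >]) (EquivClass _ _ _)).
- by move=> x; apply/asboolP.
- by move=> x y; apply/asboolP/asboolP; apply: Rsym.
- by move=> y x z /asboolP xy /asboolP yz; apply/asboolP; apply: Rtrans yz.
Defined.

End Quotient.

Record isg0 := Isg0 {
  isg_car :> Type;
  isg_mul : isg_car -> isg_car -> isg_car;
  isg_inv : isg_car -> isg_car;
  isg_zero : isg_car }.

Declare Scope isg_scope.
Delimit Scope isg_scope with S.
Notation "x * y" := (isg_mul x y) : isg_scope.
Notation "x ^-1" := (isg_inv x) : isg_scope.
Notation "0" := (isg_zero _) : isg_scope.

Definition inverse_semigroup0 (S : isg0) : Prop :=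
  [/\ associative (@isg_mul S),
      forall s : S, (0 * s = 0)%S,
      forall s : S, (s * 0 = 0)%S &
      forall s t : S, (s * t * s = s /\ t * s * t = t)%S <-> t = (s^-1)%S].

Definition isg0_hom (S T : isg0) (f : S -> T) : Prop :=
  [/\ forall s t, f (s * t)%S = (f s * f t)%S,
      forall s, f (s^-1)%S = ((f s)^-1)%S & f 0%S = 0%S].

Definition isg0_iso (S T : isg0) (f : S -> T) : Prop :=
  isg0_hom f /\ bijective f.

Definition idempotents (S : isg0) : set S := [set e | (e * e = e)%S].

Section InverseSemigroupTheory.
Variable S : isg0.
Hypothesis SP : inverse_semigroup0 S.
Local Open Scope isg_scope.
Implicit Types s t e f : S.

Lemma isgA s t u : s * (t * u) = s * t * u.
Proof. by case: SP. Qed.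

Lemma isg0x s : 0 * s = 0. Proof. by case: SP. Qed.
Lemma isgx0 s : s * 0 = 0. Proof. by case: SP. Qed.

Lemma isg_uniq s t : s * t * s = s -> t * s * t = t -> t = s^-1.
Proof. by case: SP => _ _ _ h ? ?; apply/h. Qed.

Lemma isgK s : s * s^-1 * s = s.
Proof. by case: SP => _ _ _ /(_ s s^-1)[_ /(_ erefl)[]]. Qed.

Lemma isgVK s : s^-1 * s * s^-1 = s^-1.
Proof. by case: SP => _ _ _ /(_ s s^-1)[_ /(_ erefl)[]]. Qed.

Lemma isg_invK s : s^-1^-1 = s.
Proof. by apply/esym/isg_uniq; [exact: isgVK|exact: isgK]. Qed.

Lemma isg_inv_idem e : e * e = e -> e^-1 = e.
Proof. by move=> ee; apply/esym/isg_uniq; rewrite !ee. Qed.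

Lemma isg_idemM e f : e * e = e -> f * f = f -> (e * f) * (e * f) = e * f.
Proof.
move=> ee ff; set x := (e * f)^-1.
have fxe : f * x * e = x.
  apply: isg_uniq.
    have -> : e * f * (f * x * e) * (e * f) = e * (f * f) * x * (e * e) * f.
      by rewrite !isgA.
    by rewrite ee ff -[RHS]isgK -/x !isgA.
  have -> : f * x * e * (e * f) * (f * x * e) =
            f * (x * ((e * e) * (f * f)) * x) * e by rewrite !isgA.
  by rewrite ee ff isgVK.
have xx : x * x = x.
  rewrite -{1 2}fxe.
  have -> : f * x * e * (f * x * e) = f * (x * (e * f) * x) * e.
    by rewrite !isgA.
  by rewrite isgVK -/x fxe.
have -> : e * f = x by rewrite -(isg_inv_idem xx) /x isg_invK.
by [].
Qed.

Lemma isg_idemC e f : e * e = e -> f * f = f -> e * f = f * e.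
Proof.
move=> ee ff.
have efi := isg_idemM ee ff; have fei := isg_idemM ff ee.
rewrite -(isg_inv_idem efi); apply/esym/isg_uniq.
  have -> : e * f * (f * e) * (e * f) = e * (f * f) * (e * e) * f.
    by rewrite !isgA.
  by rewrite ee ff -[RHS]efi !isgA.
have -> : f * e * (e * f) * (f * e) = f * (e * e) * (f * f) * e.
  by rewrite !isgA.
by rewrite ee ff -[RHS]fei !isgA.
Qed.

Lemma isg_idemV s : (s * s^-1) * (s * s^-1) = s * s^-1.
Proof. by rewrite isgA isgK. Qed.

Lemma isg_Videm s : (s^-1 * s) * (s^-1 * s) = s^-1 * s.
Proof. by rewrite isgA isgVK. Qed.

Lemma isg_invM s t : (s * t)^-1 = t^-1 * s^-1.
Proof.
apply/esym/isg_uniq.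
  have -> : s * t * (t^-1 * s^-1) * (s * t) =
     s * ((t * t^-1) * (s^-1 * s)) * t by rewrite !isgA.
  rewrite (isg_idemC (isg_idemV t) (isg_Videm s)).
  have -> : s * (s^-1 * s * (t * t^-1)) * t = (s * s^-1 * s) * (t * t^-1 * t).
    by rewrite !isgA.
  by rewrite !isgK.
have -> : t^-1 * s^-1 * (s * t) * (t^-1 * s^-1) =
     t^-1 * ((s^-1 * s) * (t * t^-1)) * s^-1 by rewrite !isgA.
rewrite (isg_idemC (isg_Videm s) (isg_idemV t)).
have -> : t^-1 * (t * t^-1 * (s^-1 * s)) * s^-1 =
   (t^-1 * t * t^-1) * (s^-1 * s * s^-1) by rewrite !isgA.
by rewrite !isgVK.
Qed.

Lemma isg_inv0 : (0 : S)^-1 = 0.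
Proof. by apply/esym/isg_uniq; rewrite !isgx0. Qed.

End InverseSemigroupTheory.

Inductive isg_term (G : Type) :=
| TZero
| TGen of G
| TMul of isg_term G & isg_term G
| TInv of isg_term G.
Arguments TZero {G}.

HB.instance Definition _ (G : Type) := gen_eqMixin (isg_term G).
HB.instance Definition _ (G : Type) := gen_choiceMixin (isg_term G).

Fixpoint isg_eval (G : Type) (S : isg0) (f : G -> S) (a : isg_term G) : S :=
  match a with
  | TZero => 0%S
  | TGen g => f g
  | TMul a b => (isg_eval f a * isg_eval f b)%S
  | TInv a => ((isg_eval f a)^-1)%S
  end.

Section Presentation.
Variables (G : Type) (R : isg_term G -> isg_term G -> Prop).

(* Inverse semigroups are the variety of semigroups with a unary operation    *)
(* given by the four identities pc_reg, pc_inv, pc_invM, pc_comm; see         *)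
(* presented_inverse_semigroup0 and presented_universal below.                *)
Inductive pres_cong : isg_term G -> isg_term G -> Prop :=
| pc_rel a b : R a b -> pres_cong a b
| pc_refl a : pres_cong a a
| pc_sym a b : pres_cong a b -> pres_cong b a
| pc_trans a b c : pres_cong a b -> pres_cong b c -> pres_cong a c
| pc_congM a a' b b' : pres_cong a a' -> pres_cong b b' ->
    pres_cong (TMul a b) (TMul a' b')
| pc_congV a a' : pres_cong a a' -> pres_cong (TInv a) (TInv a')
| pc_assoc a b c : pres_cong (TMul a (TMul b c)) (TMul (TMul a b) c)
| pc_0x a : pres_cong (TMul TZero a) TZero
| pc_x0 a : pres_cong (TMul a TZero) TZero
| pc_reg a : pres_cong (TMul (TMul a (TInv a)) a) a
| pc_inv a : pres_cong (TInv (TInv a)) a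
| pc_invM a b : pres_cong (TInv (TMul a b)) (TMul (TInv b) (TInv a))
| pc_comm a b : pres_cong (TMul (TMul a (TInv a)) (TMul b (TInv b)))
                          (TMul (TMul b (TInv b)) (TMul a (TInv a))).

Definition pres_equiv : equiv_rel (isg_term G) :=
  asbool_equiv pc_refl pc_sym pc_trans.

Definition presented : isg0 := {|
  isg_car := {eq_quot pres_equiv};
  isg_mul := fun x y => \pi_({eq_quot pres_equiv}) (TMul (repr x) (repr y));
  isg_inv := fun x => \pi_({eq_quot pres_equiv}) (TInv (repr x));
  isg_zero := \pi_({eq_quot pres_equiv}) TZero |}.

Definition pres_class (a : isg_term G) : presented :=
  \pi_({eq_quot pres_equiv}) a.

Definition pres_gen (g : G) : presented := pres_class (TGen g).

Lemma pres_classP a b : pres_class a = pres_class b <-> pres_cong a b.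
Proof.
split=> [/(@eqquotP _ pres_equiv)/asboolP//|h].
by apply/(@eqquotP _ pres_equiv)/asboolP.
Qed.

Lemma pres_classK (x : presented) :
  pres_class (repr (x : {eq_quot pres_equiv})) = x.
Proof. exact: reprK. Qed.

Lemma repr_class a : pres_cong (repr (pres_class a : {eq_quot pres_equiv})) a.
Proof. by apply/pres_classP; exact: pres_classK. Qed.

Lemma pres_mulE a b :
  (pres_class a * pres_class b)%S = pres_class (TMul a b).
Proof. by apply/pres_classP/pc_congM; exact: repr_class. Qed.

Lemma pres_invE a : ((pres_class a)^-1)%S = pres_class (TInv a).
Proof. by apply/pres_classP/pc_congV; exact: repr_class. Qed.

Lemma pres_evalE a : isg_eval pres_gen a = pres_class a.
Proof.
elim: a => //= [a -> b ->|a ->]; [exact: pres_mulE|exact: pres_invE].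
Qed.

Lemma presented_inverse_semigroup0 : inverse_semigroup0 presented.
Proof.
have ind (P : presented -> Prop) : (forall a, P (pres_class a)) -> forall x, P x.
  by move=> h x; rewrite -(pres_classK x).
have mulA : associative (@isg_mul presented).
  elim/ind=> a; elim/ind=> b; elim/ind=> c.
  by rewrite !pres_mulE; apply/pres_classP; exact: pc_assoc.
have reg (x : presented) : (x * x^-1 * x = x)%S.
  elim/ind: x => a.
  by rewrite pres_invE !pres_mulE; apply/pres_classP; exact: pc_reg.
have invK (x : presented) : (x^-1^-1 = x)%S.
  by elim/ind: x => a; rewrite !pres_invE; apply/pres_classP; exact: pc_inv.
have invM (x y : presented) : ((x * y)^-1 = y^-1 * x^-1)%S.
  elim/ind: x => a; elim/ind: y => b.
  by rewrite pres_mulE !pres_invE pres_mulE; apply/pres_classP; exact: pc_invM.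
have comm (x y : presented) :
    (x * x^-1 * (y * y^-1) = y * y^-1 * (x * x^-1))%S.
  elim/ind: x => a; elim/ind: y => b.
  by rewrite !pres_invE !pres_mulE; apply/pres_classP; exact: pc_comm.
have reg' (x : presented) : (x^-1 * x * x^-1 = x^-1)%S.
  by rewrite -{2}(invK x) reg.
have idV (e : presented) : (e * e = e -> e * e^-1 = e)%S.
  move=> ee.
  have vv : (e^-1 * e^-1 = e^-1)%S by rewrite -invM ee.
  have c := comm (e^-1)%S e; rewrite invK in c.
  have ve : (e^-1 = e)%S.
    have -> : (e^-1 = e^-1 * e * (e * e^-1))%S.
      by rewrite -!mulA [X in (_ * X)%S]mulA ee mulA reg'.
    by rewrite c -!mulA [X in (_ * X)%S]mulA vv mulA reg.
  by rewrite ve.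
have idC (e f : presented) : (e * e = e -> f * f = f -> e * f = f * e)%S.
  by move=> /idV ee /idV ff; rewrite -ee -ff; exact: comm.
split=> //.
- by elim/ind=> a; rewrite pres_mulE; apply/pres_classP; exact: pc_0x.
- by elim/ind=> a; rewrite pres_mulE; apply/pres_classP; exact: pc_x0.
move=> s t; split=> [[sts tst]|->]; last by [].
have id1 : (t * s * (t * s) = t * s)%S by rewrite mulA tst.
have id2 : (s^-1 * s * (s^-1 * s) = s^-1 * s)%S by rewrite mulA reg'.
have id3 : (s * t * (s * t) = s * t)%S by rewrite mulA sts.
have id4 : (s * s^-1 * (s * s^-1) = s * s^-1)%S by rewrite mulA reg.
have st : (s * t = s * s^-1)%S.
  rewrite -{1}(reg s) -(mulA (s * s^-1)%S) (idC _ _ id4 id3).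
  by rewrite mulA sts.
have ts : (t * s = s^-1 * s)%S.
  have e : (s = s * (s^-1 * s))%S by rewrite mulA reg.
  by rewrite {1}e mulA (idC _ _ id1 id2) -!mulA [X in (_ * X)%S]mulA sts.
by rewrite -tst ts -mulA st mulA reg'.
Qed.

Lemma pres_rel a b :
  R a b -> isg_eval pres_gen a = isg_eval pres_gen b.
Proof. by move=> ab; rewrite !pres_evalE; apply/pres_classP/pc_rel. Qed.

Lemma presented_universal (S : isg0) (f : G -> S) :
  inverse_semigroup0 S ->
  (forall a b, R a b -> isg_eval f a = isg_eval f b) ->
  exists! F : presented -> S, isg0_hom F /\ forall g, F (pres_gen g) = f g.
Proof.
move=> SP fR.
have ev a b : pres_cong a b -> isg_eval f a = isg_eval f b.
  elim=> //=.
  - by move=> {}a {}b c _ -> _ ->.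
  - by move=> {}a a' {}b b' _ -> _ ->.
  - by move=> {}a a' _ ->.
  - by move=> {}a {}b c; rewrite isgA.
  - by move=> {}a; rewrite isg0x.
  - by move=> {}a; rewrite isgx0.
  - by move=> {}a; rewrite isgK.
  - by move=> {}a; rewrite isg_invK.
  - by move=> {}a {}b; rewrite isg_invM.
  - by move=> {}a {}b; rewrite isg_idemC //; exact: isg_idemV.
pose F (x : presented) := isg_eval f (repr (x : {eq_quot pres_equiv})).
have FE a : F (pres_class a) = isg_eval f a by apply: ev; exact: repr_class.
exists F; split.
  split=> [|g]; last by rewrite FE.
  split=> [s t|s|]; last by rewrite FE.
  - by rewrite -(pres_classK s) -(pres_classK t) pres_mulE !FE.
  - by rewrite -(pres_classK s) pres_invE !FE.
move=> F' [[F'M F'V F'0] F'g]; apply/funext => x.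
rewrite -(pres_classK x) FE; elim: (repr _) => //=.
- by move=> g; rewrite -F'g.
- by move=> a -> b ->; rewrite -F'M pres_mulE.
- by move=> a ->; rewrite -F'V pres_invE.
Qed.

End Presentation.

Variant letter (A : Type) := Fwd of A | Bwd of A.

Section FreeGroup.
Variable A : Type.
Implicit Types (x y : letter A) (u v w : seq (letter A)).

Definition linv x := match x with Fwd a => Bwd a | Bwd a => Fwd a end.

Definition is_fwd x := if x is Fwd _ then true else false.

Definition reduced w : Prop := forall u x t, w <> u ++ [:: x, linv x & t].

Definition cancel_cons x w :=
  if w is y :: w' then if `[< y = linv x >] then w' else x :: w else [:: x].

Definition red w := foldr cancel_cons [::] w.

Definition word_inv w := rev (map linv w).

Lemma linvK : involutive linv. Proof. by case. Qed.

Lemma reduced_tl x w : reduced (x :: w) -> reduced w.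
Proof. by move=> r u y t e; apply: (r (x :: u) y t); rewrite e. Qed.

Lemma cancel_cons_reduced x w : reduced w -> reduced (cancel_cons x w).
Proof.
case: w => [|y w] r /=.
  by move=> [|? [|? ?]] ? ?.
case: asboolP => [_|nyx]; first exact: reduced_tl r.
move=> [|z u] b t /= [e1 e2]; first by case: e2 => e2 _; apply: nyx; rewrite e1.
exact: r e2.
Qed.

Lemma red_reduced w : reduced (red w).
Proof.
elim: w => [|x w]; first by move=> [|? ?].
exact: cancel_cons_reduced.
Qed.

Lemma red_id w : reduced w -> red w = w.
Proof.
elim: w => //= x w ih r; rewrite ih; last exact: reduced_tl r.
case: w r {ih} => //= y w r; case: asboolP => // e.
by exfalso; apply: (r [::] x w); rewrite e.
Qed.

Lemma cancel_consK x w : reduced w -> cancel_cons x (cancel_cons (linv x) w) = w.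
Proof.
case: w => [|y w] r /=; first by case: asboolP.
case: asboolP => [yx|nyx]; last by rewrite /=; case: asboolP.
rewrite linvK in yx; subst y.
case: w r => //= y w r; case: asboolP => // e.
by exfalso; apply: (r [::] x w); rewrite e.
Qed.

Lemma foldr_cancel_reduced u w : reduced w -> reduced (foldr cancel_cons w u).
Proof. by move=> r; elim: u => //= x u; exact: cancel_cons_reduced. Qed.

Lemma foldr_red u w : reduced w ->
  foldr cancel_cons w (red u) = foldr cancel_cons w u.
Proof.
move=> rw; elim: u => //= x u <-.
case: (red u) => //= y v; case: asboolP => // ->.
by rewrite cancel_consK //; exact: foldr_cancel_reduced.
Qed.

Lemma red_cat u v : red (u ++ v) = foldr cancel_cons (red v) u.
Proof. by rewrite /red foldr_cat. Qed.

Lemma red_catl u v : red (red u ++ v) = red (u ++ v).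
Proof. by rewrite !red_cat foldr_red //; exact: red_reduced. Qed.

Lemma red_catr u v : red (u ++ red v) = red (u ++ v).
Proof. by rewrite !red_cat red_id //; exact: red_reduced. Qed.

Lemma word_invK w : word_inv (word_inv w) = w.
Proof. by rewrite /word_inv map_rev revK (mapK linvK). Qed.

Lemma red_mulV w : red (w ++ word_inv w) = [::].
Proof.
elim: w => // x w ih.
have -> : (x :: w) ++ word_inv (x :: w) =
    x :: ((w ++ word_inv w) ++ [:: linv x]).
  by rewrite /word_inv /= rev_cons -cats1 catA.
rewrite -[LHS]/(cancel_cons x (red _)) -red_catl ih /=.
by case: asboolP.
Qed.

Record freegroup := FreeGroup { fg_word : seq (letter A); fg_wordP : reduced fg_word }.

Lemma freegroup_inj g h : fg_word g = fg_word h -> g = h.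
Proof.
by case: g h => [u ru] [v rv] /= e; subst v; congr FreeGroup; exact: Prop_irrelevance.
Qed.

Definition fg_of_word w : freegroup := FreeGroup (@red_reduced w).

Definition fg_one := fg_of_word [::].
Definition fg_mul g h := fg_of_word (fg_word g ++ fg_word h).
Definition fg_inv g := fg_of_word (word_inv (fg_word g)).

Lemma fg_mulA : associative fg_mul.
Proof. by move=> f g h; apply: freegroup_inj; rewrite /= red_catl red_catr catA. Qed.

Lemma fg_mul1g : left_id fg_one fg_mul.
Proof. by case=> w r; apply: freegroup_inj; rewrite /= red_id. Qed.

Lemma fg_mulg1 : right_id fg_one fg_mul.
Proof. by case=> w r; apply: freegroup_inj; rewrite /= cats0 red_id. Qed.

Lemma fg_mulgV : right_inverse fg_one fg_inv fg_mul.
Proof. by case=> w r; apply: freegroup_inj; rewrite /= red_catr red_mulV. Qed.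

Lemma fg_mulVg : left_inverse fg_one fg_inv fg_mul.
Proof.
case=> w r; apply: freegroup_inj; rewrite /= red_catl.
by rewrite -{2}(word_invK w) red_mulV.
Qed.

HB.instance Definition _ := gen_eqMixin freegroup.
HB.instance Definition _ := gen_choiceMixin freegroup.
HB.instance Definition _ := isGroup.Build freegroup
  fg_mulA fg_mul1g fg_mulg1 fg_mulVg fg_mulgV.

End FreeGroup.

(* Only the values of pi on nonzero elements matter.                          *)
Definition partial_hom (S : isg0) (G : groupType) (pi : S -> G) : Prop :=
  forall s t : S, (s * t)%S <> 0%S -> pi (s * t)%S = (pi s * pi t)%g.

Definition idempotent_pure (S : isg0) (G : groupType) (pi : S -> G) : Prop :=
  forall s : S, s <> 0%S -> (pi s = 1%g <-> idempotents s).

Record slat0 := Slat0 {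
  sl_car :> Type;
  sl_meet : sl_car -> sl_car -> sl_car;
  sl_bot : sl_car;
  sl_meetA : associative sl_meet;
  sl_meetC : commutative sl_meet;
  sl_meetxx : idempotent_op sl_meet;
  sl_meet0 : left_zero sl_bot sl_meet }.
Arguments sl_bot {s}.

Record is_partial_action (G : groupType) (L : slat0)
    (D : G -> set L) (theta : G -> L -> L) : Prop := {
  pa_bot : forall g, D g sl_bot;
  pa_ideal : forall g a b, D g a -> D g (sl_meet a b);
  pa_bij : forall g, set_bij (D g^-1%g) (D g) (theta g);
  pa_meet : forall g a b, D g^-1%g a -> D g^-1%g b ->
    theta g (sl_meet a b) = sl_meet (theta g a) (theta g b);
  pa_dom1 : D 1%g = setT;
  pa_act1 : forall a, theta 1%g a = a;
  pa_actM : forall g h a, D h^-1%g a -> D g^-1%g (theta h a) ->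
    D (g * h)^-1%g a /\ theta (g * h)%g a = theta g (theta h a) }.

(* pa_act g is a total function, of which only the restriction to             *)
(* pa_dom g^-1 is meaningful.                                                 *)
Record partial_action (G : groupType) (L : slat0) := PartialAction {
  pa_dom : G -> set L;
  pa_act : G -> L -> L;
  pa_axioms : is_partial_action pa_dom pa_act }.

Section Semidirect.
Variables (G : groupType) (L : slat0) (theta : partial_action G L).
Local Notation D := (pa_dom theta).
Local Notation act := (pa_act theta).

Record sd_elt := SdElt { sd_fst : L; sd_snd : G; sd_dom : D sd_snd sd_fst }.

HB.instance Definition _ := gen_eqMixin sd_elt.
HB.instance Definition _ := gen_choiceMixin sd_elt.

Lemma pa_act_dom g a : D g^-1%g a -> D g (act g a).
Proof. by case: (pa_bij (pa_axioms theta) g) => + _ _; apply. Qed.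

Lemma sd_inv_dom g a : D g a -> D g^-1%g (act g^-1%g a).
Proof. by move=> ga; apply: pa_act_dom; rewrite invgK. Qed.

Lemma sd_mul_dom g h a b : D g a -> D h b ->
  D (g * h)%g (act g (sl_meet (act g^-1%g a) b)).
Proof.
move=> ga hb; have th := pa_axioms theta.
set c := sl_meet _ b.
have gc : D g^-1%g c by apply: (pa_ideal th); exact: sd_inv_dom.
have hc : D h c by rewrite /c sl_meetC; exact: (pa_ideal th).
have [_ _ /(_ c hc)[d hd dc]] := pa_bij th h.
have gd : D g^-1%g (act h d) by rewrite dc.
have [ghd e] := pa_actM th hd gd.
by rewrite -dc -e; exact: pa_act_dom.
Qed.

(* The inverse of theta_g is theta_{g^-1}.                                    *)
Definition sd_mul (x y : sd_elt) : sd_elt :=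
  SdElt (sd_mul_dom (sd_dom x) (sd_dom y)).

Definition sd_inv (x : sd_elt) : sd_elt := SdElt (sd_inv_dom (sd_dom x)).

Definition rees (x y : sd_elt) : Prop :=
  x = y \/ sd_fst x = sl_bot /\ sd_fst y = sl_bot.

Lemma rees_refl x : rees x x. Proof. by left. Qed.

Lemma rees_sym x y : rees x y -> rees y x.
Proof. by move=> [->|[? ?]]; [left|right]. Qed.

Lemma rees_trans x y z : rees x y -> rees y z -> rees x z.
Proof. by move=> [->//|[x0 y0]] [<-|[_ z0]]; right. Qed.

Definition rees_equiv : equiv_rel sd_elt :=
  asbool_equiv rees_refl rees_sym rees_trans.

Definition semidirect : isg0 := {|
  isg_car := {eq_quot rees_equiv};
  isg_mul := fun x y => \pi_({eq_quot rees_equiv}) (sd_mul (repr x) (repr y));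
  isg_inv := fun x => \pi_({eq_quot rees_equiv}) (sd_inv (repr x));
  isg_zero := \pi_({eq_quot rees_equiv}) (SdElt (pa_bot (pa_axioms theta) 1%g)) |}.

Definition sd_delta (a : L) (g : G) (ga : D g a) : semidirect :=
  \pi_({eq_quot rees_equiv}) (SdElt ga).

End Semidirect.

Record sepgraph := SepGraph {
  vertex : Type;
  edge : Type;
  src : edge -> vertex;
  tgt : edge -> vertex;
  block : vertex -> set (set edge);
  blockP : forall v, partition (block v) id (src @^-1` [set v]) }.

Section SepGraph.
Variable E : sepgraph.

Definition blocks : set (set (edge E)) := \bigcup_v block v.

Definition hedge := letter (edge E).

Definition hsrc (x : hedge) : vertex E :=
  match x with Fwd e => src e | Bwd e => tgt e end.

Definition htgt (x : hedge) : vertex E := hsrc (linv x).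

Definition sec_term := isg_term (vertex E + hedge).
Definition tvtx (v : vertex E) : sec_term := TGen (inl v).
Definition tedg (x : hedge) : sec_term := TGen (inr x).

Inductive sec_rel : sec_term -> sec_term -> Prop :=
| sec_vv v : sec_rel (TMul (tvtx v) (tvtx v)) (tvtx v)
| sec_vw v w : v <> w -> sec_rel (TMul (tvtx v) (tvtx w)) TZero
| sec_src x : sec_rel (TMul (tvtx (hsrc x)) (tedg x)) (tedg x)
| sec_tgt x : sec_rel (TMul (tedg x) (tvtx (htgt x))) (tedg x)
| sec_ee X e : blocks X -> X e ->
    sec_rel (TMul (tedg (Bwd e)) (tedg (Fwd e))) (tvtx (tgt e))
| sec_ef X e f : blocks X -> X e -> X f -> e <> f ->
    sec_rel (TMul (tedg (Bwd e)) (tedg (Fwd f))) TZero.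

Definition SEC : isg0 := presented sec_rel.

(* A pair (v, w) stands for the word w starting at the vertex v; the pair     *)
(* (v, [::]) is the vertex v.                                                 *)
Definition gpath := (vertex E * seq hedge)%type.

Definition vpath (v : vertex E) : gpath := (v, [::]).

Definition path_src (p : gpath) : vertex E := p.1.
Definition path_tgt (p : gpath) : vertex E := foldl (fun _ x => htgt x) p.1 p.2.

Fixpoint composable (v : vertex E) (w : seq hedge) : Prop :=
  if w is x :: w' then hsrc x = v /\ composable (htgt x) w' else True.

Definition is_path (p : gpath) : Prop := composable p.1 p.2.

(* Meaningful when path_tgt p = path_src q.                                   *)
Definition path_mul (p q : gpath) : gpath := (p.1, red (p.2 ++ q.2)).

Definition path_inv (p : gpath) : gpath := (path_tgt p, word_inv p.2).

Definition omega (p : gpath) : freegroup (edge E) := fg_of_word p.2.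

Definition sep_path (p : gpath) : Prop :=
  [/\ is_path p, reduced p.2 &
      forall X u e f t, blocks X -> X e -> X f ->
        p.2 <> u ++ [:: Bwd e, Fwd f & t]].

Definition FC (v : vertex E) : set gpath :=
  [set p | sep_path p /\ path_src p = v].

Definition prefix_le (p q : gpath) : Prop :=
  p.1 = q.1 /\ exists t, q.2 = p.2 ++ t.

Fixpoint strip_bwd (w : seq hedge) : seq hedge :=
  if w is x :: w' then if has (@is_fwd _) w then x :: strip_bwd w' else [::]
  else [::].

(* p = g0 p . w with w a product of inverse edges, see g0P.                   *)
Definition g0 (p : gpath) : gpath := (p.1, strip_bwd p.2).

Lemma g0P v u t : ~~ has (@is_fwd _) t ->
  u = [::] \/ (exists u' e, u = rcons u' (Fwd e)) -> g0 (v, u ++ t) = (v, u).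
Proof.
rewrite /g0 /= => nt uP; congr pair.
case: uP => [->|[u' [e ->]]] {u}.
  by case: t nt => //= x t; case: ifP.
elim: u' => [|x u ih] /=.
  by case: t nt => //= x t; case: ifP.
by rewrite ih has_cat has_rcons /= !orbT.
Qed.

Definition compat (v : vertex E) (p q : gpath) : Prop :=
  [\/ p = vpath v, q = vpath v | sep_path (path_mul (path_inv q) p)].

Definition compatible_at (v : vertex E) (A : set gpath) : Prop :=
  A `<=` FC v /\ forall p q, A p -> A q -> compat v p q.

Definition C_compatible (A : set gpath) : Prop :=
  exists v, compatible_at v A.

Definition lower (A : set gpath) : Prop :=
  forall p q, A q -> prefix_le p q -> A p.

Definition inX (v : vertex E) (A : set gpath) : Prop :=
  [/\ A !=set0, finite_set A, lower A & compatible_at v A].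

(* None is the zero element of the semilattice.                               *)
Definition Xcar := option {A : set gpath | exists v, inX v A}.

Definition toX (A : set gpath) : Xcar :=
  if pselect (exists v, inX v A) is left AX then Some (exist _ A AX) else None.

(* If A is in X(v) and B is in X(w), then A `|` B is a nonempty finite lower  *)
(* set, so it is in some X(u) iff v = w = u and A `|` B is C-compatible.      *)
Definition Xmeet (a b : Xcar) : Xcar :=
  if (a, b) is (Some A, Some B) then toX (sval A `|` sval B) else None.

Lemma toX_Some A v (AX : inX v A) : exists h, toX A = Some (exist _ A h).
Proof. by rewrite /toX; case: pselect => [h|[]]; [exists h|exists v]. Qed.

Lemma toX_val (A : {A : set gpath | exists v, inX v A}) : toX (sval A) = Some A.
Proof.
case: A => A AX; rewrite /toX /=; case: pselect => // h.
by congr (Some (exist _ _ _)); exact: Prop_irrelevance.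
Qed.

Lemma Xmeet_toX A (B : {A : set gpath | exists v, inX v A}) :
  A !=set0 -> finite_set A -> lower A ->
  Xmeet (toX A) (Some B) = toX (A `|` sval B).
Proof.
move=> A0 Af Al; rewrite {1}/toX; case: pselect => // nA /=.
rewrite /toX; case: pselect => // h; exfalso.
case: h => v [_ _ _ [sub cmp]]; apply: nA; exists v; split=> //; split; [move=> p Ap|move=> p q Ap Aq].
  by apply: sub; left.
by apply: cmp; left.
Qed.

Lemma XmeetC : commutative Xmeet.
Proof. by move=> [A|] [B|] //; rewrite /Xmeet setUC. Qed.

Lemma XmeetA : associative Xmeet.
Proof.
have U (A B : {A : set gpath | exists v, inX v A}) :
    [/\ sval A `|` sval B !=set0, finite_set (sval A `|` sval B) &
        lower (sval A `|` sval B)].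
  case: A B => [A [v [[p Ap] Af Al _]]] [B [w [_ Bf Bl _]]] /=; split.
  - by exists p; left.
  - by rewrite finite_setU.
  - by move=> r q [Aq|Bq] rq; [left; apply: Al rq|right; apply: Bl rq].
move=> [A|] [B|] [C|] //; last by rewrite /Xmeet; case: (toX _).
have [AB0 ABf ABl] := U A B; have [BC0 BCf BCl] := U B C.
rewrite -[RHS]/(Xmeet (toX (sval A `|` sval B)) (Some C)).
rewrite -[LHS]/(Xmeet (Some A) (toX (sval B `|` sval C))).
by rewrite XmeetC !Xmeet_toX // setUC setUA.
Qed.

Lemma Xmeetxx : idempotent_op Xmeet.
Proof. by move=> [A|] //; rewrite /Xmeet setUid toX_val. Qed.

Lemma Xmeet0 : left_zero None Xmeet.
Proof. by []. Qed.

Definition Xlat : slat0 := Slat0 XmeetA XmeetC Xmeetxx Xmeet0.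

HB.instance Definition _ := gen_eqMixin Xcar.
HB.instance Definition _ := gen_choiceMixin Xcar.

Definition down (p : gpath) : set gpath := [set q | prefix_le q p].

Inductive Ycong : Xcar -> Xcar -> Prop :=
| Y_gen g e : sep_path g -> path_tgt g = tgt e -> reduced (rcons g.2 (Bwd e)) ->
    Ycong (toX (down g)) (toX (down (g.1, rcons g.2 (Bwd e))))
| Y_refl a : Ycong a a
| Y_sym a b : Ycong a b -> Ycong b a
| Y_trans a b c : Ycong a b -> Ycong b c -> Ycong a c
| Y_meet a a' b b' : Ycong a a' -> Ycong b b' ->
    Ycong (Xmeet a b) (Xmeet a' b').

Definition Yequiv : equiv_rel Xcar := asbool_equiv Y_refl Y_sym Y_trans.

Local Notation Ycar := {eq_quot Yequiv}.

Definition Ymeet (a b : Ycar) : Ycar := \pi_(Ycar) (Xmeet (repr a) (repr b)).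

Lemma Ymeet_pi (a b : Xcar) :
  Ymeet (\pi_(Ycar) a) (\pi_(Ycar) b) = \pi_(Ycar) (Xmeet a b).
Proof.
have rP c : Ycong (repr (\pi_(Ycar) c)) c.
  by apply/asboolP/(@eqquotP _ Yequiv); exact: reprK.
by apply/(@eqquotP _ Yequiv)/asboolP/Y_meet; exact: rP.
Qed.

Lemma YmeetA : associative Ymeet.
Proof.
move=> a b c; rewrite -[a]reprK -[b]reprK -[c]reprK.
rewrite (Ymeet_pi (repr b) (repr c)) (Ymeet_pi (repr a) (repr b)).
rewrite (Ymeet_pi (repr a) (Xmeet (repr b) (repr c))).
by rewrite (Ymeet_pi (Xmeet (repr a) (repr b)) (repr c)) XmeetA.
Qed.

Lemma YmeetC : commutative Ymeet.
Proof. by move=> a b; rewrite /Ymeet XmeetC. Qed.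

Lemma Ymeetxx : idempotent_op Ymeet.
Proof. by move=> a; rewrite /Ymeet Xmeetxx reprK. Qed.

Lemma Ymeet0 : left_zero (\pi_(Ycar) None) Ymeet.
Proof. by move=> a; rewrite -[a]reprK Ymeet_pi. Qed.

Definition Ylat : slat0 := Slat0 YmeetA YmeetC Ymeetxx Ymeet0.

(* Meaningful when A is in some X(v); toX sends any other set to zero.        *)
Definition Yclass (A : set gpath) : Ylat := \pi_(Ycar) (toX A).

Definition low0 (I : set gpath) : set gpath :=
  [set p | exists2 g, I g & prefix_le p (g0 g)].

Definition inX0 (v : vertex E) (I : set gpath) : Prop :=
  inX v I /\ low0 I = I.

Definition representative (v : vertex E) (T T' : set gpath) : Prop :=
  inX v T' /\ low0 T' = T.

(* Meaningful when all the elements of T start at path_tgt g.                 *)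
Definition translate (g : gpath) (T : set gpath) : set gpath :=
  [set path_mul g t | t in T].

Record munn_tree := MunnTree {
  mt_set : set gpath;
  mt_end : gpath;
  mt_setP : inX0 (path_src mt_end) mt_set;
  mt_endP : sep_path mt_end;
  mt_in : mt_set (g0 mt_end) }.

Definition mt_root (t : munn_tree) : vertex E := path_src (mt_end t).

(* None is the adjoined zero element.                                         *)
Definition munn0 := option munn_tree.

Definition munn_product (mul : munn0 -> munn0 -> munn0) : Prop :=
  [/\ forall a, mul None a = None, forall a, mul a None = None &
      forall (t1 t2 : munn_tree) (T1 T2 : set gpath),
        representative (mt_root t1) (mt_set t1) T1 -> T1 (mt_end t1) ->
        representative (mt_root t2) (mt_set t2) T2 -> T2 (mt_end t2) ->
        let U := T1 `|` translate (mt_end t1) T2 in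
        let nonzero := path_tgt (mt_end t1) = mt_root t2 /\ C_compatible U in
        (nonzero -> exists t, [/\ mul (Some t1) (Some t2) = Some t,
           mt_set t = low0 U & mt_end t = path_mul (mt_end t1) (mt_end t2)]) /\
        (~ nonzero -> mul (Some t1) (Some t2) = None)].

Definition munn_inverse (inv : munn0 -> munn0) : Prop :=
  inv None = None /\
  forall (t : munn_tree) (T' : set gpath),
    representative (mt_root t) (mt_set t) T' -> T' (mt_end t) ->
    exists t', [/\ inv (Some t) = Some t',
      mt_set t' = low0 (translate (path_inv (mt_end t)) T') &
      mt_end t' = path_inv (mt_end t)].

Definition munn (mul : munn0 -> munn0 -> munn0) (inv : munn0 -> munn0) : isg0 :=
  {| isg_car := munn0; isg_mul := mul; isg_inv := inv; isg_zero := None |}.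

(* The value at zero is irrelevant, see partial_hom.                          *)
Definition munn_omega (a : munn0) : freegroup (edge E) :=
  if a is Some t then omega (mt_end t) else 1%g.

End SepGraph.

Arguments vpath {E}.
Arguments toX {E}.
Arguments Yclass {E}.
Arguments munn_omega {E}.

(* psi identifies the semilattice L with the idempotents of S.                *)
Definition idempotent_iso (L : slat0) (S : isg0) (psi : L -> S) : Prop :=
  [/\ set_bij setT (idempotents (S := S)) psi,
      forall a b, psi (sl_meet a b) = (psi a * psi b)%S & psi sl_bot = 0%S].

(* theta is the partial action on the idempotents of S (identified with L     *)
(* through psi) determined by the idempotent pure partial homomorphism pi.    *)
Definition determined_action (S : isg0) (G : groupType) (pi : S -> G)
    (L : slat0) (psi : L -> S) (theta : partial_action G L) : Prop :=
  (forall g a, pa_dom theta g a <->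
     a = sl_bot \/
     exists s : S, [/\ s <> 0%S, pi s = g & psi a = (s * s^-1)%S]) /\
  (forall (s : S) a, s <> 0%S -> psi a = (s^-1 * s)%S ->
     psi (pa_act theta (pi s) a) = (s * s^-1)%S).

Definition semidirect_decomposition (S : isg0) (G : groupType) (pi : S -> G)
    (L : slat0) (psi : L -> S) (theta : partial_action G L) : Prop :=
  exists2 Phi : semidirect theta -> S, isg0_iso Phi &
    forall a g (ga : pa_dom theta g a) (s : S),
      s <> 0%S -> pi s = g -> psi a = (s * s^-1)%S ->
      Phi (sd_delta ga) = s.

(* Main.v *)
From HB Require Import structures.
From mathcomp Require Import all_boot finmap.
From mathcomp Require Import boolp classical_sets functions cardinality.
Require Import Defs.

Set Implicit Arguments.
Unset Strict Implicit.
Unset Printing Implicit Defensive.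

Local Open Scope classical_set_scope.
Local Open Scope quotient_scope.

(** The elements of the inverse semigroup of a separated graph have a normal
    form: each nonzero element is a product [I T * P g], where [P g] is the
    product of the generators along a reduced path [g] and [I T] is the product
    of the idempotents [P t * (P t)^-1] over the points [t] of a finite tree [T]
    of reduced paths that contains [g].

    Existence rests on the natural partial order. Cancelling a factor [x * x^-1]
    in a product can only enlarge it, so [P u * P t] lies below the element of
    the reduced path [u * t] ([path_elt_mul]). Used for a path and for its
    inverse, this gives [P g * I T = I (g * T) * P g] ([tree_idem_translate]),
    and the formulas for products and inverses of Munn trees follow
    ([munn_elt_mul], [munn_elt_inv]). The relations [e^-1 * e = r(e)] make [I T]
    depend only on the tree without its final inverse edges ([tree_idem_low0]),
    and the relations [e^-1 * f = 0] make [I T] vanish when [T] is not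
    compatible ([tree_idem0]).

    For uniqueness, let [T] be compatible. The generators act by partial
    injections, [x] sending [h] to [h * x], on the paths [h] whose part [g0 h]
    lies in [T]; compatibility of [T] is what makes this action satisfy the
    relations ([saturation_sep]). An element [I U * P h] moves the base point
    exactly when [U] and [h] lie in that set, and then moves it to [h]. This
    recovers the Munn tree from the element ([munn_elt_inj]), and shows that a
    tree [T] is compatible if and only if [I T] is not zero. That criterion
    settles every later question of compatibility without combinatorics.

    Munn trees are therefore in bijection with the semigroup, and their product
    and inverse are the transported ones. The same computations identify the
    semilattice of classes of trees with the idempotents, by [T |-> I T]
    ([Xidem_inj]). The degree [(T, g) |-> omega g] is idempotent pure since only
    trivial reduced words have trivial image in the free group. The partial
    action and the semidirect product exist for every idempotent pure partial
    homomorphism, because such a map, together with the range, separates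
    nonzero elements ([degree_ran_inj], [da_semidirect]). *)

(** * The natural partial order of an inverse semigroup *)

Section NaturalOrder.
Variable S : isg0.
Hypothesis SP : inverse_semigroup0 S.
Local Open Scope isg_scope.
Implicit Types s t u e f : S.

Definition nle s t := exists2 e, e * e = e & s = e * t.

Lemma nle_refl s : nle s s.
Proof. by exists (s * s^-1); [exact: isg_idemV|rewrite isgK]. Qed.

Lemma nle_trans t s u : nle s t -> nle t u -> nle s u.
Proof.
move=> [e ee ->] [f ff ->]; exists (e * f); last by rewrite isgA.
exact: isg_idemM.
Qed.

Lemma isg_conj_idem s e :
  e * e = e -> (s * e * s^-1) * (s * e * s^-1) = s * e * s^-1.
Proof.
move=> ee; have := isg_idemC SP ee (isg_Videm SP s) => c.
transitivity (s * (e * (s^-1 * s)) * e * s^-1); first by rewrite !(isgA SP).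
by rewrite c !(isgA SP) isgK // -(isgA SP s e e) ee.
Qed.

(** A left restriction [e * t] is the right restriction of [t] by the conjugate
    of [e], and conversely; so the order is compatible with products on both
    sides and with inversion. *)
Lemma isg_mul_idem s e : e * e = e -> s * e = s * e * s^-1 * s.
Proof.
move=> ee; rewrite -[in RHS](isgA SP (s * e)) -(isgA SP s e).
by rewrite (isg_idemC SP ee (isg_Videm SP s)) !(isgA SP) isgK.
Qed.

Lemma nle_idemr s e : e * e = e -> nle (s * e) s.
Proof.
by move=> ee; exists (s * e * s^-1); [exact: isg_conj_idem|exact: isg_mul_idem].
Qed.

Lemma nle_mulr u s t : nle s t -> nle (s * u) (t * u).
Proof. by move=> [e ee ->]; exists e => //; rewrite isgA. Qed.

Lemma nle_mull u s t : nle s t -> nle (u * s) (u * t).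
Proof.
move=> [e ee ->]; rewrite (isgA SP) (isg_mul_idem u ee) -(isgA SP _ u).
by exists (u * e * u^-1) => //; exact: isg_conj_idem.
Qed.

Lemma nle_mul s t s' t' : nle s t -> nle s' t' -> nle (s * s') (t * t').
Proof. by move=> st st'; apply: nle_trans (nle_mulr _ st) (nle_mull _ st'). Qed.

Lemma nle_inv s t : nle s t -> nle (s^-1) (t^-1).
Proof.
move=> [e ee ->]; rewrite isg_invM // (isg_inv_idem SP ee).
exact: nle_idemr.
Qed.

Lemma nle_ran s t : nle s t -> nle (s * s^-1) (t * t^-1).
Proof. by move=> st; exact: nle_mul st (nle_inv st). Qed.

(** The idempotent of the definition can always be chosen to be the range. *)
Lemma nleE s t : nle s t -> s = s * s^-1 * t.
Proof.
move=> [e ee ->]; rewrite (isg_invM SP) (isg_inv_idem SP ee).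
have -> : e * t * (t^-1 * e) * t = e * ((t * t^-1) * e) * t by rewrite !(isgA SP).
rewrite (isg_idemC SP (isg_idemV SP t) ee) -!(isgA SP).
by rewrite !(isgA SP t) isgK // !(isgA SP) ee.
Qed.

Lemma nle_idem e f : f * f = f -> nle e f -> e * f = e.
Proof. by move=> ff [h hh ->]; rewrite -isgA // ff. Qed.

Lemma nle_anti e f : e * e = e -> f * f = f -> nle e f -> nle f e -> e = f.
Proof.
move=> ee ff /(nle_idem ff) ef /(nle_idem ee) fe.
by rewrite -ef (isg_idemC SP ee ff).
Qed.

Lemma nle0 s : nle s 0 -> s = 0.
Proof. by move=> [e _ ->]; rewrite isgx0. Qed.

Lemma isg_ran0 s : s * s^-1 = 0 -> s = 0.
Proof. by move=> s0; rewrite -(isgK SP s) s0 isg0x. Qed.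

Lemma isg_inv_neq0 s : s <> 0 -> s^-1 <> 0.
Proof. by move=> s0 e; apply: s0; rewrite -(isg_invK SP s) e isg_inv0. Qed.

End NaturalOrder.

(** * The partial action determined by an idempotent pure partial homomorphism *)

Section DeterminedAction.
Variables (S : isg0) (G : groupType) (pi : S -> G) (L : slat0) (psi : L -> S).
Hypotheses (SP : inverse_semigroup0 S) (piM : partial_hom pi)
  (piI : idempotent_pure pi) (psiI : idempotent_iso psi).
Local Open Scope isg_scope.
Implicit Types (s t u e f : S) (a b c : L) (g h : G).

Let psi_inj : injective psi.
Proof.
by move=> a b ab; case: psiI => -[_ inj _] _ _; apply: inj; rewrite ?inE.
Qed.

Let psiM a b : psi (sl_meet a b) = psi a * psi b.
Proof. by case: psiI. Qed.

Let psi0 : psi sl_bot = 0.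
Proof. by case: psiI. Qed.

Let psi_id a : psi a * psi a = psi a.
Proof. by rewrite -psiM sl_meetxx. Qed.

Let psi_onto e : e * e = e -> exists a, psi a = e.
Proof. by move=> ee; case: psiI => -[_ _ /(_ e ee)[a _ <-]] _ _; exists a. Qed.

Let psi_neq0 a : a <> sl_bot -> psi a <> 0.
Proof. by move=> a0 e; apply: a0; apply: psi_inj; rewrite e psi0. Qed.

Let pi_idem e : e * e = e -> e <> 0 -> pi e = 1%g.
Proof. by move=> ee e0; apply/piI. Qed.

Let piV s : s <> 0 -> pi (s^-1) = ((pi s)^-1)%g.
Proof.
move=> s0; have ss0 : s * s^-1 <> 0 by move=> /(isg_ran0 SP).
have := piM ss0; rewrite pi_idem //; last exact: isg_idemV.
by move=> e; rewrite -[LHS](mulKg (pi s)) -e mulg1.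
Qed.

Let pi_idemM e s : e * e = e -> e * s <> 0 -> pi (e * s) = pi s.
Proof.
move=> ee es0; rewrite piM // pi_idem ?mul1g // => e0.
by apply: es0; rewrite e0 isg0x.
Qed.

(** For two elements with the same degree and the same range, [s^-1 * t] has
    degree one, hence is idempotent, which makes [s] and [t] restrictions of each
    other. *)
Lemma degree_ran_inj s t :
  s <> 0 -> pi s = pi t -> s * s^-1 = t * t^-1 -> s = t.
Proof.
have le u w : u <> 0 -> pi u = pi w -> u * u^-1 = w * w^-1 -> nle u w.
  move=> u0 p e.
  have w0 : w <> 0.
    by move=> w0; apply: u0; apply: (isg_ran0 SP); rewrite e w0 isg0x.
  have x0 : w^-1 * u <> 0.
    move=> x0; apply: u0; rewrite -(isgK SP u) e -(isgA SP) x0.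
    by rewrite isgx0.
  have xx : (w^-1 * u) * (w^-1 * u) = w^-1 * u.
    by apply/(piI x0); rewrite (piM x0) p piV // mulVg.
  have -> : u = w * (w^-1 * u) by rewrite isgA // -e isgK.
  exact: nle_idemr.
move=> s0 p e; have t0 : t <> 0.
  by move=> t0; apply: s0; apply: (isg_ran0 SP); rewrite e t0 isg0x.
by rewrite (nleE SP (le s t s0 p e)) e isgK.
Qed.

Lemma degree_dom_inj s t :
  s <> 0 -> pi s = pi t -> s^-1 * s = t^-1 * t -> s = t.
Proof.
move=> s0 p e; have t0 : t <> 0.
  move=> t0; move: e; rewrite t0 isgx0 // => e.
  by apply: s0; rewrite -(isgK SP s) -isgA // e isgx0.
rewrite -(isg_invK SP s) -(isg_invK SP t); congr (_^-1).
apply: degree_ran_inj; first exact: isg_inv_neq0.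
  by rewrite !piV // p.
by rewrite !isg_invK.
Qed.

Definition da_dom g : set L := [set a | a = sl_bot \/
  exists s, [/\ s <> 0, pi s = g & psi a = s * s^-1]].

Definition da_graph g a b := exists s,
  [/\ s <> 0, pi s = g, psi a = s^-1 * s & psi b = s * s^-1].

(** No element carries the bottom, so the default value is what makes the action
    send bottom to bottom. *)
Definition da_act g a : L :=
  xget (sl_bot : {classic L}) [set b | da_graph g a b].

Let da_graph_fun g a b c : da_graph g a b -> da_graph g a c -> b = c.
Proof.
move=> [s [s0 sg sa sb]] [t [t0 tg ta tc]]; apply: psi_inj; rewrite sb tc.
by rewrite (@degree_dom_inj s t) ?sg ?tg // -sa -ta.
Qed.

Let da_graphV g a b : da_graph g a b -> da_graph (g^-1)%g b a.
Proof.
move=> [s [s0 sg sa sb]]; exists (s^-1); split; first exact: isg_inv_neq0.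
- by rewrite piV // sg.
- by rewrite isg_invK.
- by rewrite isg_invK.
Qed.

Let da_actE g a b : da_graph g a b -> da_act g a = b.
Proof.
move=> ab; apply: (@da_graph_fun g a) => //.
exact: (@xgetPex {classic L} sl_bot (da_graph g a) (ex_intro _ b ab)).
Qed.

Let da_act0 g : da_act g sl_bot = sl_bot.
Proof.
rewrite /da_act; case: xgetP => // b -> [s [s0 _]].
rewrite psi0 => e _; exfalso.
by apply: s0; rewrite -(isgK SP s) -isgA // -e isgx0.
Qed.

Let da_graph_dom g a b : da_graph g a b -> da_dom g b.
Proof. by move=> [s [? ? _ ?]]; right; exists s. Qed.

Let da_graph_neq0 g a b : da_graph g a b -> a <> sl_bot.
Proof.
move=> [s [s0 _ sa _]] a0; apply: s0.
by rewrite -(isgK SP s) -isgA // -sa a0 psi0 isgx0.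
Qed.

Let da_domP g a : da_dom (g^-1)%g a -> a = sl_bot \/ exists b, da_graph g a b.
Proof.
move=> [->|[s [s0 sg sa]]]; first by left.
right; have [b sb] := psi_onto (isg_Videm SP s).
exists b; rewrite -(invgK g); apply: da_graphV.
by exists s.
Qed.

Let da_graphM g h a b c :
  da_graph h a b -> da_graph g b c -> da_graph (g * h)%g a c.
Proof.
move=> [s [s0 sh sa sb]] [t [t0 tg tb tc]].
have e : t * s * s^-1 = t by rewrite -isgA // -sb tb isgA // isgK.
have ts0 : t * s <> 0 by move=> z; apply: t0; rewrite -e z isg0x.
exists (t * s); split=> //; first by rewrite piM // tg sh.
  by rewrite isg_invM // isgA // -(isgA SP (s^-1)) -tb sb isgA // isgVK.
by rewrite isg_invM // isgA // e.
Qed.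

(** If [s] and [t] carry [a] to [a'] and [b] to [b'], then [s * psi b] and
    [t * psi a] have the same degree and the same domain, so they coincide. The
    image of the meet of [a] and [b] is hence below both [a'] and [b']. Equality
    with the meet of [a'] and [b'] comes from the same statement for the inverse
    degree. *)
Let da_graph_meet g a a' b b' : da_graph g a a' -> da_graph g b b' ->
  sl_meet a b <> sl_bot ->
  exists2 c, da_graph g (sl_meet a b) c & sl_meet c (sl_meet a' b') = c.
Proof.
move=> [s [s0 sg sa sa']] [t [t0 tg tb tb']] ab0.
have res u x y : pi u = g -> psi x = u^-1 * u -> sl_meet x y <> sl_bot ->
    [/\ u * psi y <> 0, pi (u * psi y) = g &
        (u * psi y)^-1 * (u * psi y) = psi (sl_meet x y)].
  move=> ug ux xy0.
  have d : (u * psi y)^-1 * (u * psi y) = psi (sl_meet x y).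
    rewrite isg_invM // (isg_inv_idem SP (psi_id y)).
    have -> : psi y * u^-1 * (u * psi y) = psi y * (u^-1 * u) * psi y.
      by rewrite !(isgA SP).
    by rewrite -ux -!psiM (sl_meetC y) -sl_meetA sl_meetxx.
  have z : u * psi y <> 0.
    by move=> z; apply: (psi_neq0 xy0); rewrite -d z isgx0.
  split=> //; rewrite piM // (pi_idem (psi_id y)) ?mulg1 // => e.
  by apply: z; rewrite e isgx0.
have [u0 ug ud] := res s a b sg sa ab0.
have [w0 wg wd] : [/\ t * psi a <> 0, pi (t * psi a) = g &
    (t * psi a)^-1 * (t * psi a) = psi (sl_meet a b)].
  by rewrite (sl_meetC a); apply: res => //; rewrite sl_meetC.
have uw : s * psi b = t * psi a by apply: degree_dom_inj; rewrite ?ug ?wg // ud.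
have [c cE] := psi_onto (isg_idemV SP (s * psi b)).
exists c; first by exists (s * psi b).
have lea : nle (psi c) (psi a').
  by rewrite cE sa'; apply: nle_ran => //; exact: nle_idemr.
have leb : nle (psi c) (psi b').
  by rewrite cE uw tb'; apply: nle_ran => //; exact: nle_idemr.
apply: psi_inj; rewrite !psiM isgA //.
by rewrite (nle_idem SP (psi_id a') lea) (nle_idem SP (psi_id b') leb).
Qed.

Lemma determined_actionP : is_partial_action da_dom da_act.
Proof.
split.
- by move=> g; left.
- move=> g a b [->|[s [s0 sg sa]]]; first by left; exact: sl_meet0.
  have E : psi b * s * (psi b * s)^-1 = psi (sl_meet a b).
    rewrite isg_invM // (isg_inv_idem SP (psi_id b)).
    have -> : psi b * s * (s^-1 * psi b) = psi b * (s * s^-1) * psi b.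
      by rewrite !(isgA SP).
    by rewrite -sa -!psiM (sl_meetC b) -sl_meetA sl_meetxx.
  have [z|z] := pselect (psi b * s = 0).
    by left; apply: psi_inj; rewrite -E z psi0 isg0x.
  by right; exists (psi b * s); rewrite pi_idemM // sg.
- move=> g; split.
  + move=> a /da_domP[->|[b ab]]; first by rewrite da_act0; left.
    by rewrite (da_actE ab); exact: da_graph_dom ab.
  + move=> a b; rewrite !inE => /da_domP[->|[a' aa']] /da_domP[->|[b' bb']] //.
    * rewrite da_act0 (da_actE bb') => e; have := da_graphV bb'.
      by move/da_graph_neq0; rewrite -e.
    * rewrite da_act0 (da_actE aa') => e; have := da_graphV aa'.
      by move/da_graph_neq0; rewrite e.
    * rewrite (da_actE aa') (da_actE bb') => e; subst b'.
      exact: da_graph_fun (da_graphV aa') (da_graphV bb').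
  + move=> b; rewrite -{1}(invgK g) => /da_domP[->|[a ba]].
      by exists sl_bot; [left|exact: da_act0].
    exists a; first exact: da_graph_dom ba.
    by have := da_graphV ba; rewrite invgK => /da_actE.
- move=> g a b /da_domP[->|[a' aa']]; first by rewrite !(sl_meet0, da_act0).
  move=> /da_domP[->|[b' bb']].
    by rewrite !(sl_meetC _ sl_bot) sl_meet0 da_act0 sl_meetC sl_meet0.
  rewrite (da_actE aa') (da_actE bb').
  have [ab'0|ab'0] := pselect (sl_meet a' b' = sl_bot).
    rewrite ab'0; have [->|ab0] := pselect (sl_meet a b = sl_bot).
      exact: da_act0.
    have [c cab] := da_graph_meet aa' bb' ab0.
    by rewrite (da_actE cab) ab'0 sl_meetC sl_meet0.
  have [d dab' dle] := da_graph_meet (da_graphV aa') (da_graphV bb') ab'0.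
  have dab := da_graphV dab'; rewrite invgK in dab.
  have [ab0|ab0] := pselect (sl_meet a b = sl_bot).
    by case: (da_graph_neq0 dab); rewrite -dle ab0 sl_meetC sl_meet0.
  have [c cab cle] := da_graph_meet aa' bb' ab0.
  rewrite (da_actE cab); apply/esym.
  have [e ede] : exists2 e, da_graph g (sl_meet d (sl_meet a b)) e &
      sl_meet e (sl_meet (sl_meet a' b') c) = e.
    by apply: (da_graph_meet dab cab); rewrite dle; exact: (da_graph_neq0 dab).
  rewrite dle in ede; rewrite (da_graph_fun ede dab).
  by rewrite sl_meetA sl_meetxx sl_meetC cle.
- apply/seteqP; split=> // a _; have [->|a0] := pselect (a = sl_bot); first by left.
  right; exists (psi a); split; first exact: psi_neq0.
    by apply: pi_idem => //; exact: psi_neq0.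
  by rewrite (isg_inv_idem SP (psi_id a)).
- move=> a; have [->|a0] := pselect (a = sl_bot); first exact: da_act0.
  apply: da_actE; exists (psi a); rewrite (isg_inv_idem SP (psi_id a)) psi_id.
  by split=> //; [exact: psi_neq0|apply: pi_idem => //; exact: psi_neq0].
- move=> g h a /da_domP[->|[b ab]].
    by rewrite !da_act0; split=> //; left.
  rewrite (da_actE ab) => /da_domP[b0|[c bc]].
    by have := da_graphV ab; move/da_graph_neq0; rewrite b0.
  have ac := da_graphM ab bc.
  rewrite (da_actE ac) (da_actE bc); split=> //.
  exact: da_graph_dom (da_graphV ac).
Qed.

Definition da_action := PartialAction determined_actionP.

Lemma da_determined : determined_action pi psi da_action.
Proof.
split=> // s a s0 sa; have [b bE] := psi_onto (isg_idemV SP s).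
by rewrite -bE; congr psi; apply: da_actE; exists s.
Qed.

Local Notation sd := (sd_elt da_action).

(** The element of the semigroup named by a pair; the default value takes care
    of the pairs that the Rees quotient identifies with zero. *)
Definition sd_real (x : sd) : S :=
  xget (0 : {classic S})
    [set s | [/\ s <> 0, pi s = sd_snd x & psi (sd_fst x) = s * s^-1]].

Lemma sd_realE (x : sd) s :
  s <> 0 -> pi s = sd_snd x -> psi (sd_fst x) = s * s^-1 -> sd_real x = s.
Proof.
move=> s0 sp sx; rewrite /sd_real; case: xgetP => [t -> [t0 tp tx]|/(_ s)[]//].
by apply: degree_ran_inj => //; rewrite ?tp ?sp // -tx.
Qed.

Lemma sd_real0 (x : sd) : sd_fst x = sl_bot -> sd_real x = 0.
Proof.
move=> x0; rewrite /sd_real; case: xgetP => // t -> [t0 _].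
by rewrite x0 psi0 => /esym/(isg_ran0 SP).
Qed.

Lemma sd_realP (x : sd) : sd_fst x <> sl_bot ->
  [/\ sd_real x <> 0, pi (sd_real x) = sd_snd x &
      psi (sd_fst x) = sd_real x * (sd_real x)^-1].
Proof.
by move=> x0; case: (sd_dom x) => // -[s [s0 sp sx]]; rewrite (sd_realE s0 sp sx).
Qed.

Lemma sd_real_eq0 (x : sd) : sd_real x = 0 -> sd_fst x = sl_bot.
Proof. by have [//|/sd_realP[]] := pselect (sd_fst x = sl_bot). Qed.

Lemma rees_sd_real (x y : sd) : rees x y -> sd_real x = sd_real y.
Proof. by move=> [->//|[x0 y0]]; rewrite !sd_real0. Qed.

Lemma sd_real_inj (x y : sd) : sd_real x = sd_real y -> rees x y.
Proof.
move=> xy; have [x0|x0] := pselect (sd_fst x = sl_bot).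
  by right; split=> //; apply: sd_real_eq0; rewrite -xy sd_real0.
have [y0|y0] := pselect (sd_fst y = sl_bot).
  by right; split=> //; apply: sd_real_eq0; rewrite xy sd_real0.
left; have [_ xp xf] := sd_realP x0; have [_ yp yf] := sd_realP y0.
have: sd_snd x = sd_snd y by rewrite -xp -yp xy.
have: sd_fst x = sd_fst y by apply: psi_inj; rewrite xf yf xy.
case: x y {xy x0 y0 xp xf yp yf} => a g d [b h d'] /= ab gh; subst b h.
by congr SdElt; exact: Prop_irrelevance.
Qed.

Let act_real (x : sd) : sd_fst x <> sl_bot ->
  psi (da_act ((sd_snd x)^-1)%g (sd_fst x)) = (sd_real x)^-1 * sd_real x.
Proof.
move=> x0; have [r0 rp rf] := sd_realP x0.
have [b bE] := psi_onto (isg_Videm SP (sd_real x)).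
rewrite -bE; congr psi; apply: da_actE; apply: da_graphV.
by exists (sd_real x).
Qed.

Lemma sd_real_inv (x : sd) : sd_real (sd_inv x) = (sd_real x)^-1.
Proof.
have [x0|x0] := pselect (sd_fst x = sl_bot).
  by rewrite !sd_real0 //= ?x0 ?da_act0 // isg_inv0.
have [r0 rp rf] := sd_realP x0; apply: sd_realE => /=.
- exact: isg_inv_neq0.
- by rewrite piV // rp.
- by rewrite act_real // isg_invK.
Qed.

(** With [s], [t] the elements named by [x], [y] and [c] the meet of the domain
    of [s] with the range of [t], the product [s * t] has range
    [s * c * s^-1], which is the value at [c] of the action of [s]. *)
Lemma sd_real_mul (x y : sd) : sd_real (sd_mul x y) = sd_real x * sd_real y.
Proof.
have [x0|x0] := pselect (sd_fst x = sl_bot).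
  rewrite (sd_real0 x0) isg0x //; apply: sd_real0 => /=.
  by rewrite x0 da_act0 sl_meet0 da_act0.
have [y0|y0] := pselect (sd_fst y = sl_bot).
  rewrite (sd_real0 y0) isgx0 //; apply: sd_real0 => /=.
  by rewrite y0 sl_meetC sl_meet0 da_act0.
have [r0 rp rf] := sd_realP x0; have [q0 qp qf] := sd_realP y0.
have ar := act_real x0.
set s := sd_real x in r0 rp rf ar *; set t := sd_real y in q0 qp qf *.
set c := sl_meet (da_act ((sd_snd x)^-1)%g (sd_fst x)) (sd_fst y).
have cE : psi c = s^-1 * s * (t * t^-1) by rewrite psiM ar qf.
have sc : s * psi c = s * (t * t^-1) by rewrite cE !(isgA SP) isgK.
have [st0|st0] := pselect (s * t = 0).
  rewrite st0; apply: sd_real0 => /=; rewrite -/c.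
  suff -> : c = sl_bot by exact: da_act0.
  apply: psi_inj; rewrite cE psi0.
  have -> : s^-1 * s * (t * t^-1) = s^-1 * (s * t) * t^-1 by rewrite !(isgA SP).
  by rewrite st0 isgx0 // isg0x.
have sc0 : s * psi c <> 0.
  by rewrite sc => z; apply: st0; rewrite -[t in LHS](isgK SP) (isgA SP) z isg0x.
apply: sd_realE => //=; first by rewrite piM // rp qp.
have [d dE] := psi_onto (isg_idemV SP (s * t)).
rewrite -dE -/c; congr psi; apply: da_actE; exists (s * psi c).
split=> //.
  rewrite piM // rp (pi_idem (psi_id c)) ?mulg1 // => z.
  by apply: sc0; rewrite z isgx0.
  rewrite isg_invM // (isg_inv_idem SP (psi_id c)).
  have -> : psi c * s^-1 * (s * psi c) = psi c * (s^-1 * s * psi c).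
    by rewrite !(isgA SP).
  by rewrite -ar -!psiM [sl_meet (da_act _ _) c]sl_meetA !sl_meetxx.
rewrite dE sc (isg_invM SP s t) (isg_invM SP s (t * t^-1)).
rewrite (isg_inv_idem SP (isg_idemV SP t)).
have -> : s * (t * t^-1) * (t * t^-1 * s^-1) =
    s * ((t * t^-1) * (t * t^-1)) * s^-1 by rewrite !(isgA SP).
by rewrite isg_idemV // !(isgA SP).
Qed.

Lemma da_semidirect : semidirect_decomposition pi psi da_action.
Proof.
pose Phi (q : semidirect da_action) : S :=
  sd_real (repr (q : {eq_quot rees_equiv da_action})).
have PhiE (x : sd) : Phi (\pi_({eq_quot rees_equiv da_action}) x) = sd_real x.
  apply: rees_sd_real; apply/asboolP/(@eqquotP _ (rees_equiv da_action)).
  exact: reprK.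
have ind (P : semidirect da_action -> Prop) :
    (forall x, P (\pi_({eq_quot rees_equiv da_action}) x)) -> forall q, P q.
  by move=> h q; rewrite -[q](@reprK _ {eq_quot rees_equiv da_action}).
exists Phi; last first.
  by move=> a g ga s s0 sg sa; rewrite /sd_delta PhiE; exact: sd_realE.
split.
  split.
  - by move=> q r; rewrite [LHS]PhiE sd_real_mul.
  - by move=> q; rewrite [LHS]PhiE sd_real_inv.
  - by rewrite [LHS]PhiE sd_real0.
have Phi_inj : injective Phi.
  elim/ind=> x; elim/ind=> y; rewrite !PhiE => /sd_real_inj xy.
  by apply/(@eqquotP _ (rees_equiv da_action)); apply/asboolP.
have Phi_onto s : exists q, Phi q = s.
  have [b bE] := psi_onto (isg_idemV SP s).
  have [->|s0] := pselect (s = 0).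
    exists (0 : semidirect da_action); by rewrite PhiE sd_real0.
  have bd : pa_dom da_action (pi s) b by right; exists s.
  exists (sd_delta bd); rewrite PhiE; exact: sd_realE.
pose inv s : semidirect da_action := sval (cid (Phi_onto s)).
have invK : cancel inv Phi by move=> s; rewrite /inv; case: cid.
by exists inv => // q; apply: Phi_inj; rewrite invK.
Qed.

End DeterminedAction.

(** * Reduced words and paths *)

(* Classical equality and choice, so that finite sets of paths can be listed. *)
HB.instance Definition _ (A : Type) := gen_eqMixin (letter A).
HB.instance Definition _ (A : Type) := gen_choiceMixin (letter A).
HB.instance Definition _ (E : sepgraph) := gen_eqMixin (vertex E).
HB.instance Definition _ (E : sepgraph) := gen_choiceMixin (vertex E).

Section ReducedWords.
Variable A : Type.
Implicit Types (x y : letter A) (u v w : seq (letter A)).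

Lemma reduced_nil : reduced ([::] : seq (letter A)).
Proof. by case. Qed.

Lemma reduced_catl u v : reduced (u ++ v) -> reduced u.
Proof. by move=> r a x t e; apply: (r a x (t ++ v)); rewrite e -catA. Qed.

Lemma reduced_rconsl w x : reduced (rcons w x) -> reduced w.
Proof. by rewrite -cats1; exact: reduced_catl. Qed.

Lemma word_inv_cat u v : word_inv (u ++ v) = word_inv v ++ word_inv u.
Proof. by rewrite /word_inv map_cat rev_cat. Qed.

Lemma word_inv_rcons w x : word_inv (rcons w x) = linv x :: word_inv w.
Proof. by rewrite -cats1 word_inv_cat. Qed.

Lemma word_inv_cons w x : word_inv (x :: w) = rcons (word_inv w) (linv x).
Proof. by rewrite /word_inv /= rev_cons. Qed.

Lemma word_inv_reduced w : reduced w -> reduced (word_inv w).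
Proof.
move=> r u x t /(congr1 (@word_inv A)); rewrite word_invK word_inv_cat.
rewrite !word_inv_cons -!cats1 -!catA /= linvK.
exact: r.
Qed.

Lemma red_Vmul w : red (word_inv w ++ w) = [::].
Proof. by rewrite -{2}(word_invK w) red_mulV. Qed.

Lemma red_mulVK u v : red (word_inv u ++ red (u ++ v)) = red v.
Proof. by rewrite red_catr catA -red_catl red_Vmul. Qed.

Lemma reduced_rcons w x : reduced w ->
  (exists w', w = rcons w' (linv x)) \/ reduced (rcons w x).
Proof.
move=> rw; have [|h] := pselect (exists w', w = rcons w' (linv x)); first by left.
right=> u y t; case/lastP: t => [|t z] /=.
  rewrite -cats1 -[[:: y; _]]/([:: y] ++ [:: linv y]) catA !cats1.
  by move/rcons_inj => [wE xE]; apply: h; exists u; rewrite wE xE linvK.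
rewrite -!rcons_cons -rcons_cat => /rcons_inj[wE _].
exact: rw wE.
Qed.

Lemma red_rcons_cancel w x : reduced w -> red (rcons (rcons w (linv x)) x) = w.
Proof.
move=> rw; rewrite -!cats1 -catA -red_catr /=.
by rewrite linvK; case: asboolP => // _; rewrite cats0 red_id.
Qed.

End ReducedWords.

Section Paths.
Variable E : sepgraph.
Implicit Types (T : set (gpath E)) (p q g t : gpath E) (v : vertex E)
  (x : hedge E) (w : seq (hedge E)).

(** The elements of the fundamental groupoid. *)
Definition rpath p := is_path p /\ reduced p.2.

Lemma sep_rpath p : sep_path p -> rpath p.
Proof. by case. Qed.

Lemma rpath_vpath v : rpath (vpath v).
Proof. by split=> //=; exact: reduced_nil. Qed.

Lemma path_tgt_rcons v w x : path_tgt (v, rcons w x) = htgt x.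
Proof. by rewrite /path_tgt /= foldl_rcons. Qed.

Lemma composable_cat v u w : composable v (u ++ w) <->
  composable v u /\ composable (path_tgt (v, u)) w.
Proof.
elim: u v => [|x u ih] v /=; first by split=> [|[]].
split=> [[? /ih[? ?]]|[[? ?] ?]] //.
by split=> //; apply/ih.
Qed.

Lemma is_path_rcons v w x :
  is_path (v, rcons w x) <-> is_path (v, w) /\ hsrc x = path_tgt (v, w).
Proof.
rewrite /is_path /= -cats1 composable_cat /=.
by split=> [[? []]|[]].
Qed.

Lemma rpath_rconsl v w x : rpath (v, rcons w x) -> rpath (v, w).
Proof. by move=> [/is_path_rcons[? _] /reduced_rconsl]. Qed.

Lemma path_tgt_cat v u w : path_tgt (v, u ++ w) = path_tgt (path_tgt (v, u), w).
Proof. by rewrite /path_tgt /= foldl_cat. Qed.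

Lemma red_path v w : is_path (v, w) ->
  is_path (v, red w) /\ path_tgt (v, red w) = path_tgt (v, w).
Proof.
rewrite /is_path /path_tgt /=; elim: w v => //= x w ih v [xv /ih[]].
case: (red w) => [|y w'] /=; first by move=> _ e; rewrite -e.
case: asboolP => [->|_] /=; last by move=> [? ?] e; rewrite -e.
by rewrite /htgt linvK xv => -[].
Qed.

Lemma path_mulP p q : is_path p -> is_path q -> path_tgt p = path_src q ->
  [/\ rpath (path_mul p q), path_src (path_mul p q) = path_src p &
      path_tgt (path_mul p q) = path_tgt q].
Proof.
case: p q => [v u] [z w] pp qq; rewrite /path_src /= => e; subst z.
have /red_path[rp rt] : is_path (v, u ++ w) by apply/composable_cat.
by rewrite path_tgt_cat in rt; split=> //; split=> //; exact: red_reduced.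
Qed.

Lemma path_invP p : is_path p ->
  is_path (path_inv p) /\ path_tgt (path_inv p) = path_src p.
Proof.
case: p => v; elim/last_ind => [|w x ih] //= /is_path_rcons[/ih[ip it] xw].
rewrite /path_inv path_tgt_rcons /= word_inv_rcons /is_path /path_tgt /=.
by rewrite /htgt linvK xw.
Qed.

Lemma rpath_inv p : rpath p -> rpath (path_inv p).
Proof. by move=> [/path_invP[]]; split=> //; exact: word_inv_reduced. Qed.

Lemma path_invK p : is_path p -> path_inv (path_inv p) = p.
Proof.
by case: p => v w /path_invP[_ e]; rewrite /path_inv e /= word_invK.
Qed.

Lemma path_mulVK g t : rpath t -> is_path g -> path_tgt g = path_src t ->
  path_mul (path_inv g) (path_mul g t) = t.
Proof.
case: g t => [v u] [z w] [_ rw] pg /= e.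
by rewrite /path_mul /= red_mulVK red_id // e.
Qed.

Lemma path_mulg1 g v : rpath g -> path_mul g (vpath v) = g.
Proof. by case: g => u w [_ r]; rewrite /path_mul cats0 red_id. Qed.

Lemma path_mulVg g : path_mul (path_inv g) g = vpath (path_tgt g).
Proof. by rewrite /path_mul /= red_Vmul. Qed.

Lemma path_mul_rcons g v w x :
  path_mul g (v, rcons w x) = path_mul (path_mul g (v, w)) (hsrc x, [:: x]).
Proof. by rewrite /path_mul /= red_catl -catA cats1. Qed.

Variant step_spec v w x : gpath E -> Prop :=
| StepCancel w' of w = rcons w' (linv x) : step_spec v w x (v, w')
| StepGrow of reduced (rcons w x) : step_spec v w x (v, rcons w x).

Lemma stepP v w x : reduced w ->
  step_spec v w x (path_mul (v, w) (hsrc x, [:: x])).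
Proof.
move=> rw; rewrite /path_mul /= cats1.
case: (reduced_rcons x rw) => [[w' wE]|r]; last by rewrite red_id //; right.
by rewrite wE red_rcons_cancel; [left|move: rw; rewrite wE => /reduced_rconsl].
Qed.

Lemma prefix_refl p : prefix_le p p.
Proof. by split=> //; exists [::]; rewrite cats0. Qed.

Lemma prefix_trans p q t : prefix_le p q -> prefix_le q t -> prefix_le p t.
Proof.
move=> [pq [a qE]] [qt [b tE]]; split; first by rewrite pq.
by exists (a ++ b); rewrite tE qE catA.
Qed.

Lemma prefix_rcons q v w x : prefix_le q (v, rcons w x) ->
  q = (v, rcons w x) \/ prefix_le q (v, w).
Proof.
case: q => u z [/= -> [t]]; case/lastP: t => [|t y].
  by rewrite cats0 => ->; left.
by rewrite -rcons_cat => /rcons_inj[-> _]; right; split=> //; exists t.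
Qed.

Lemma prefix_nil q v : prefix_le q (v, [::]) -> q = vpath v.
Proof. by case: q => u [|? ?] [/= -> [t]]. Qed.

Lemma prefix_rpath p q : prefix_le p q -> rpath q -> rpath p.
Proof.
case: p q => [v u] [v' w] [/= -> [t ->]] [/composable_cat[? _] /reduced_catl].
by split.
Qed.

(** The Cayley graph of the fundamental groupoid is a forest: the geodesic from
    the base point to [g * t] lies in the union of the geodesic to [g] and of the
    translate by [g] of the geodesic to [t]. *)
Lemma prefix_mul g t q : rpath g -> rpath t -> path_tgt g = path_src t ->
  prefix_le q (path_mul g t) ->
  prefix_le q g \/ exists2 s, prefix_le s t & q = path_mul g s.
Proof.
case: t => v w rg; elim/last_ind: w q => [|w x ih] q rt gt.
  by rewrite path_mulg1 //; left.
have rt' := rpath_rconsl rt.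
have ih' p : prefix_le p (path_mul g (v, w)) -> prefix_le p g \/
    exists2 s, prefix_le s (v, rcons w x) & p = path_mul g s.
  move=> /(ih _ rt' gt)[|[s sw ->]]; [by left|right; exists s => //].
  by apply: prefix_trans sw _; split=> //; exists [:: x]; rewrite cats1.
have [qE|nq] := pselect (q = path_mul g (v, rcons w x)).
  by move=> _; right; exists (v, rcons w x) => //; exact: prefix_refl.
move: nq; rewrite path_mul_rcons.
case gwE : (path_mul g (v, w)) => [u z].
have rz : reduced z by have := @red_reduced _ (g.2 ++ w); case: gwE => _ <-.
case: stepP => // [z' zE|rzx] nq.
  move=> qz; apply: ih'; rewrite gwE; apply: prefix_trans qz _.
  by split=> //; exists [:: linv x]; rewrite zE cats1.
by move=> /prefix_rcons[//|qz]; apply: ih'; rewrite gwE.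
Qed.

Lemma sep_path_prefix p q : prefix_le p q -> sep_path q -> sep_path p.
Proof.
move=> pq [iq rq sq]; have [ip rp] := prefix_rpath pq (conj iq rq).
split=> // X u e f t bX Xe Xf pE; case: pq => _ [z qE].
by apply: (sq X u e f (t ++ z) bX Xe Xf); rewrite qE pE -catA.
Qed.

Lemma g0_rcons_fwd v w e : g0 (v, rcons w (Fwd e)) = (v, rcons w (Fwd e)).
Proof.
by rewrite -{1}[rcons _ _]cats0; apply: g0P => //; right; exists w, e.
Qed.

Lemma g0_rcons_bwd v w e : g0 (v, rcons w (Bwd e)) = g0 (v, w).
Proof.
congr pair; rewrite /=; elim: w => //= x w ->.
by rewrite -cats1 has_cat /= !orbF.
Qed.

Lemma g0_prefix p : prefix_le (g0 p) p.
Proof.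
case: p => v w; split=> //=; elim: w => [|x w [t e]]; first by exists [::].
rewrite /=; case: ifP => _; last by exists (x :: w).
by exists t; rewrite {1}e.
Qed.

Lemma prefix_g0 p q : prefix_le p q -> prefix_le (g0 p) (g0 q).
Proof.
case: q => v w; elim/last_ind: w p => [|w x ih] p.
  by move=> /prefix_nil ->; exact: prefix_refl.
move=> /prefix_rcons[->|/ih pw]; first exact: prefix_refl.
apply: prefix_trans pw _; case: x => e; last first.
  by rewrite g0_rcons_bwd; exact: prefix_refl.
rewrite g0_rcons_fwd; apply: prefix_trans (g0_prefix _) _.
by split=> //; exists [:: Fwd e]; rewrite cats1.
Qed.

Lemma g0_idem p : g0 (g0 p) = g0 p.
Proof.
case: p => v; elim/last_ind => // w [e|e] ih; last by rewrite g0_rcons_bwd.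
by rewrite !g0_rcons_fwd.
Qed.

Lemma prefix_vpath p : prefix_le (vpath p.1) p.
Proof. by split=> //; exists p.2. Qed.

Lemma lower_down p : lower (down p).
Proof. by move=> q t tp qt; exact: prefix_trans qt tp. Qed.

Lemma finite_down p : finite_set (down p).
Proof.
case: p => v; elim/last_ind => [|w x ih].
  by apply: (@sub_finite_set _ _ [set vpath v]) => // q /prefix_nil.
apply: (@sub_finite_set _ _ ((v, rcons w x) |` down (v, w))).
  by move=> q /prefix_rcons.
by rewrite finite_setU; split.
Qed.

Lemma low0_sub T : lower T -> low0 T `<=` T.
Proof.
move=> lT p [g Tg pg]; apply: lT Tg _.
exact: prefix_trans pg (g0_prefix g).
Qed.

Lemma lower_low0 T : lower (low0 T).
Proof. by move=> p q [g Tg qg] pq; exists g => //; exact: prefix_trans pq qg. Qed.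

Lemma low0_g0 T g : T g -> low0 T (g0 g).
Proof. by move=> Tg; exists g => //; exact: prefix_refl. Qed.

Lemma low0_idem T : lower T -> low0 (low0 T) = low0 T.
Proof.
move=> lT; apply/seteqP; split; first by apply: low0_sub; exact: lower_low0.
move=> p [g Tg pg]; exists (g0 g); first exact: low0_g0.
by rewrite g0_idem.
Qed.

End Paths.

(** * Path elements and tree idempotents in a representation *)

Section Representation.
Variables (E : sepgraph) (S : isg0) (f : vertex E + hedge E -> S).
Hypothesis SP : inverse_semigroup0 S.
Local Open Scope isg_scope.
Implicit Types (p q g t : gpath E) (T U : set (gpath E)) (s : S).

Definition path_elt p : S :=
  foldl (fun s x => s * f (inr x)) (f (inl p.1)) p.2.

Definition path_idem p : S := path_elt p * (path_elt p)^-1.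

(** The fold starts at a member of the list because the semigroup has no unit to
    serve as an empty meet. *)
Definition meet_seq (ps : seq (gpath E)) : S :=
  if ps is p :: ps' then foldr (fun q e => path_idem q * e) (path_idem p) ps'
  else 0.

Definition tree_idem T : S := meet_seq (fset_set T).

Lemma path_idemP p : path_idem p * path_idem p = path_idem p.
Proof. exact: isg_idemV. Qed.

(** The product is the greatest lower bound; all comparisons of tree idempotents
    go through this property, which ignores order and repetitions. *)
Lemma meet_seqP ps :
  [/\ meet_seq ps * meet_seq ps = meet_seq ps,
      forall p, p \in ps -> nle (meet_seq ps) (path_idem p) &
      forall e, e * e = e -> (exists p, p \in ps) ->
        (forall p, p \in ps -> nle e (path_idem p)) -> nle e (meet_seq ps)].
Proof.
case: ps => [|p ps].
  by split=> //=; [rewrite isg0x|move=> e _ []].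
elim: ps => [|q ps [/= ih1 ih2 ih3]] /=.
  split; first exact: path_idemP.
    by move=> t; rewrite inE => /eqP ->; exact: nle_refl.
  by move=> e _ _; apply; rewrite inE.
set m := foldr _ _ _ in ih1 ih2 ih3 *.
have mq : nle (path_idem q * m) (path_idem q) by exact: nle_idemr.
have mm : nle (path_idem q * m) m by exists (path_idem q) => //; exact: path_idemP.
split; first by apply: isg_idemM => //; exact: path_idemP.
  move=> t; rewrite !inE => /or3P[tp|/eqP -> //|tps].
    by apply: (nle_trans SP mm (ih2 _ _)); rewrite inE tp.
  by apply: (nle_trans SP mm (ih2 _ _)); rewrite inE tps orbT.
move=> e ee _ le; rewrite -ee; apply: nle_mul => //.
  by apply: le; rewrite !inE eqxx orbT.
apply: ih3 => //; first by exists p; rewrite inE eqxx.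
by move=> t; rewrite inE => /orP[tp|tps]; apply: le; rewrite !inE ?tp ?tps ?orbT.
Qed.

Lemma tree_idem_idem T : tree_idem T * tree_idem T = tree_idem T.
Proof. by case: (meet_seqP (fset_set T)). Qed.

Lemma tree_idem_le T p : finite_set T -> T p -> nle (tree_idem T) (path_idem p).
Proof.
move=> Tf Tp; case: (meet_seqP (fset_set T)) => _ + _; apply.
by rewrite in_fset_set // inE.
Qed.

Lemma tree_idem_glb T e : finite_set T -> T !=set0 -> e * e = e ->
  (forall p, T p -> nle e (path_idem p)) -> nle e (tree_idem T).
Proof.
move=> Tf [p Tp] ee le; case: (meet_seqP (fset_set T)) => _ _; apply=> //.
  by exists p; rewrite in_fset_set // inE.
by move=> q; rewrite in_fset_set // inE => /le.
Qed.

Lemma tree_idem_eq T U : finite_set T -> finite_set U -> T !=set0 -> U !=set0 ->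
  (forall p, T p -> exists2 q, U q & nle (path_idem q) (path_idem p)) ->
  (forall p, U p -> exists2 q, T q & nle (path_idem q) (path_idem p)) ->
  tree_idem T = tree_idem U.
Proof.
move=> Tf Uf T0 U0 TU UT.
apply: nle_anti => //; try exact: tree_idem_idem.
  apply: tree_idem_glb => //; first exact: tree_idem_idem.
  by move=> p /UT[q Tq]; apply: nle_trans => //; exact: tree_idem_le.
apply: tree_idem_glb => //; first exact: tree_idem_idem.
by move=> p /TU[q Tq]; apply: nle_trans => //; exact: tree_idem_le.
Qed.

Lemma tree_idemU T U : finite_set T -> finite_set U -> T !=set0 -> U !=set0 ->
  tree_idem (T `|` U) = tree_idem T * tree_idem U.
Proof.
move=> Tf Uf [t Tt] [u Uu].
have TUf : finite_set (T `|` U) by rewrite finite_setU.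
have TU0 : T `|` U !=set0 by exists t; left.
have Ti := tree_idem_idem T; have Ui := tree_idem_idem U.
apply: nle_anti => //; first exact: tree_idem_idem.
- exact: isg_idemM.
- rewrite -[X in nle X _]tree_idem_idem; apply: nle_mul => //.
    apply: tree_idem_glb => //; [by exists t|exact: tree_idem_idem|].
    by move=> p Tp; apply: tree_idem_le => //; left.
  apply: tree_idem_glb => //; [by exists u|exact: tree_idem_idem|].
  by move=> p Up; apply: tree_idem_le => //; right.
- apply: tree_idem_glb => //; first exact: isg_idemM.
  move=> p [Tp|Up].
    by apply: (nle_trans SP (nle_idemr SP _ Ui)); exact: tree_idem_le.
  have le : nle (tree_idem T * tree_idem U) (tree_idem U) by exists (tree_idem T).
  by apply: (nle_trans SP le); exact: tree_idem_le.
Qed.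

Hypothesis fR : forall a b, sec_rel a b -> isg_eval f a = isg_eval f b.

Lemma edge_block (e : edge E) : exists2 X, blocks X & X e.
Proof.
have [UE _ _] := blockP (src e).
have: (@src E @^-1` [set src e]) e by [].
rewrite -UE => -[X bX Xe]; exists X => //; by exists (src e).
Qed.

Lemma rep_vv v : f (inl v) * f (inl v) = f (inl v).
Proof. exact: fR (sec_vv v). Qed.

Lemma rep_vw v w : v <> w -> f (inl v) * f (inl w) = 0.
Proof. by move=> /(@sec_vw E)/fR. Qed.

Lemma rep_src x : f (inl (hsrc x)) * f (inr x) = f (inr x).
Proof. exact: fR (sec_src x). Qed.

Lemma rep_tgt x : f (inr x) * f (inl (htgt x)) = f (inr x).
Proof. exact: fR (sec_tgt x). Qed.

Lemma rep_ee e : f (inr (Bwd e)) * f (inr (Fwd e)) = f (inl (tgt e)).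
Proof. by have [X bX Xe] := edge_block e; exact: fR (sec_ee bX Xe). Qed.

Lemma rep_ef X e h : blocks X -> X e -> X h -> e <> h ->
  f (inr (Bwd e)) * f (inr (Fwd h)) = 0.
Proof. by move=> bX Xe Xh eh; exact: fR (sec_ef bX Xe Xh eh). Qed.

Lemma rep_vV v : (f (inl v))^-1 = f (inl v).
Proof. by rewrite isg_inv_idem // rep_vv. Qed.

(** The relations make [x] and [linv x] mutually inverse, so the claim is the
    uniqueness of inverses. *)
Lemma rep_linv x : f (inr (linv x)) = (f (inr x))^-1.
Proof.
have h e : f (inr (Bwd e)) = (f (inr (Fwd e)))^-1.
  apply: isg_uniq => //; first by rewrite -isgA // rep_ee (rep_tgt (Fwd e)).
  by rewrite rep_ee (rep_src (Bwd e)).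
by case: x => e /=; rewrite h ?isg_invK.
Qed.

Lemma path_elt_rcons v w x :
  path_elt (v, rcons w x) = path_elt (v, w) * f (inr x).
Proof. by rewrite /path_elt /= foldl_rcons. Qed.

Lemma path_elt_src p : f (inl (path_src p)) * path_elt p = path_elt p.
Proof.
case: p => v; elim/last_ind => [|w x ih]; first exact: rep_vv.
by rewrite path_elt_rcons isgA // ih.
Qed.

Lemma path_elt_tgt p : path_elt p * f (inl (path_tgt p)) = path_elt p.
Proof.
case: p => v; elim/last_ind => [|w x ih]; first exact: rep_vv.
by rewrite path_elt_rcons path_tgt_rcons -isgA // rep_tgt.
Qed.

Lemma path_elt_cons x w :
  path_elt (hsrc x, x :: w) = f (inr x) * path_elt (htgt x, w).
Proof.
elim/last_ind: w => [|w y ih].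
  by rewrite /path_elt /= rep_src rep_tgt.
by rewrite -rcons_cons !path_elt_rcons ih isgA.
Qed.

Lemma path_elt_inv p : is_path p -> path_elt (path_inv p) = (path_elt p)^-1.
Proof.
case: p => v; elim/last_ind => [|w x ih]; first by rewrite /path_elt /= rep_vV.
move=> /is_path_rcons[wp xw]; rewrite path_elt_rcons isg_invM // -ih // -rep_linv.
rewrite /path_inv path_tgt_rcons /= word_inv_rcons.
by rewrite /htgt path_elt_cons /htgt linvK xw.
Qed.

(** Cancelling [x * x^-1] inside a word replaces an idempotent factor by the
    identity, so the element of a word lies below the one of its reduction. *)
Lemma path_elt_mul p q : rpath p -> is_path q -> path_tgt p = path_src q ->
  nle (path_elt p * path_elt q) (path_elt (path_mul p q)).
Proof.
case: q => v; elim/last_ind => [|w x ih] rp.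
  move=> _ /= e; rewrite path_mulg1 //.
  by rewrite -{1}[v]e path_elt_tgt; exact: nle_refl.
move=> /is_path_rcons[wp xw] pv; rewrite path_elt_rcons isgA //.
apply: (nle_trans SP (nle_mulr SP _ (ih rp wp pv))).
rewrite path_mul_rcons.
have [[_ rz] _ _] := path_mulP (proj1 rp) wp pv.
case: (path_mul p (v, w)) rz => u z rz.
case: stepP => // [z' ->|_]; last by rewrite path_elt_rcons; exact: nle_refl.
rewrite path_elt_rcons -isgA //; apply: nle_idemr => //.
by rewrite rep_linv; exact: isg_Videm.
Qed.

Lemma path_elt_bad p X u e h w : p.2 = u ++ [:: Bwd e, Fwd h & w] ->
  blocks X -> X e -> X h -> e <> h -> path_elt p = 0.
Proof.
case: p => v z /= -> bX Xe Xh eh; rewrite /path_elt /= foldl_cat /=.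
rewrite -(isgA SP) (rep_ef bX Xe Xh eh) isgx0 //.
by elim: w => //= x w ih; rewrite isg0x.
Qed.

Lemma path_elt0 p : rpath p -> ~ sep_path p -> path_elt p = 0.
Proof.
move=> [ip rp] ns; apply: contrapT => p0; apply: ns; split=> //.
move=> X u e h t bX Xe Xh pE; apply: p0; apply: (path_elt_bad pE bX Xe Xh).
by move=> eh; apply: (rp u (Bwd e) t); rewrite pE eh.
Qed.

Lemma path_idem_vpath v : path_idem (vpath v) = f (inl v).
Proof. by rewrite /path_idem /path_elt /= rep_vV rep_vv. Qed.

Lemma path_idem_prefix p q : prefix_le p q -> nle (path_idem q) (path_idem p).
Proof.
case: p q => [v u] [_ _] [/= <- [t ->]]; elim/last_ind: t => [|t x ih].
  by rewrite cats0; exact: nle_refl.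
apply: (nle_trans SP _ ih); rewrite -rcons_cat /path_idem path_elt_rcons.
rewrite isg_invM // isgA // -(isgA SP (path_elt _)).
apply: nle_mulr => //; apply: nle_idemr => //; exact: isg_idemV.
Qed.

(** The relation [e^-1 * e = r(e)] turns the last factor into a vertex, which the
    rest of the path absorbs. This matches the generators of the congruence on
    the semilattice of trees. *)
Lemma path_idem_bwd v w e : is_path (v, rcons w (Bwd e)) ->
  path_idem (v, rcons w (Bwd e)) = path_idem (v, w).
Proof.
move=> /is_path_rcons[_ e'].
rewrite /path_idem path_elt_rcons isg_invM // -(rep_linv (Bwd e)) /=.
rewrite !isgA // -(isgA SP _ (f _) (f _)) rep_ee.
by rewrite -[tgt e]/(hsrc (Bwd e)) e' path_elt_tgt.
Qed.

Lemma path_idem_g0 p : is_path p -> path_idem (g0 p) = path_idem p.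
Proof.
case: p => v; elim/last_ind => // w [e|e] ih ip; first by rewrite g0_rcons_fwd.
rewrite g0_rcons_bwd path_idem_bwd //; apply: ih.
by case/is_path_rcons: ip.
Qed.

Lemma tree_idem_down p : tree_idem (down p) = path_idem p.
Proof.
have dp : down p p by exact: prefix_refl.
apply: nle_anti => //; [exact: tree_idem_idem|exact: path_idemP| |].
  by apply: tree_idem_le => //; exact: finite_down.
apply: tree_idem_glb; [exact: finite_down|by exists p|exact: path_idemP|].
by move=> q; exact: path_idem_prefix.
Qed.

(** The members of X(v) without the condition of compatibility, which may fail
    for the trees formed in a product. *)
Definition subtree v T :=
  [/\ finite_set T, lower T, T (vpath v) &
      forall p, T p -> rpath p /\ path_src p = v].

Lemma subtree_neq0 v T : subtree v T -> T !=set0.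
Proof. by move=> [_ _ Tv _]; exists (vpath v). Qed.

Lemma tree_idem_low0 v T : subtree v T -> tree_idem (low0 T) = tree_idem T.
Proof.
move=> [Tf Tl Tv Tp]; have sT := low0_sub Tl; apply/esym.
have l0f : finite_set (low0 T) by exact: sub_finite_set Tf.
apply: tree_idem_eq => //.
- by exists (vpath v).
- by exists (vpath v); exact: (low0_g0 Tv).
- move=> p pT; exists (g0 p); first exact: low0_g0.
  by rewrite path_idem_g0; [exact: nle_refl|case: (Tp _ pT) => -[]].
- by move=> p /sT pT; exists p => //; exact: nle_refl.
Qed.

Lemma subtree_translate g v T : rpath g -> path_src g = v ->
  subtree (path_tgt g) T -> 
  [/\ finite_set (translate g T), translate g T g &
    forall p, translate g T p -> rpath p /\ path_src p = v].
Proof.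
move=> rg gv [Tf Tl Tv Tp]; split; first exact: finite_image.
  by exists (vpath (path_tgt g)) => //; rewrite path_mulg1.
move=> _ [t Tt <-]; have [[it _] ts] := Tp _ Tt.
by have [rgt -> _] := path_mulP (proj1 rg) it (esym ts).
Qed.

(** Conjugation by a path element translates trees: both inequalities come from
    [path_elt_mul], applied to [g] and to its inverse. *)
Lemma tree_idem_translate g T : rpath g -> subtree (path_tgt g) T ->
  path_elt g * tree_idem T * (path_elt g)^-1 = tree_idem (translate g T).
Proof.
move=> rg sT; have [Tf Tl Tv Tp] := sT.
have [gTf gTg gTp] := subtree_translate rg erefl sT.
have Ti := tree_idem_idem T; have gTi := tree_idem_idem (translate g T).
apply: nle_anti => //; first exact: isg_conj_idem.
  apply: tree_idem_glb => //; [by exists g|exact: isg_conj_idem|].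
  move=> _ [t Tt <-]; have [[it rt] ts] := Tp _ Tt.
  have le : nle (path_elt g * tree_idem T * (path_elt g)^-1)
      ((path_elt g * path_elt t) * (path_elt g * path_elt t)^-1).
    rewrite isg_invM // !isgA //; apply: nle_mulr => //.
    by rewrite -isgA //; apply: nle_mull => //; exact: tree_idem_le.
  by apply: (nle_trans SP le); apply: nle_ran => //; exact: path_elt_mul.
have ggT : tree_idem (translate g T) * path_idem g = tree_idem (translate g T).
  by apply: nle_idem => //; [exact: path_idemP|exact: tree_idem_le].
have Ggt : path_idem g * tree_idem (translate g T) = tree_idem (translate g T).
  by rewrite isg_idemC //; exact: path_idemP.
have -> : tree_idem (translate g T) = path_elt g *
    ((path_elt g)^-1 * tree_idem (translate g T) * path_elt g) * (path_elt g)^-1.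
  by rewrite !isgA // -/(path_idem g) Ggt -isgA // ggT.
apply: nle_mulr => //; apply: nle_mull => //.
have ci := isg_conj_idem SP ((path_elt g)^-1) gTi; rewrite isg_invK // in ci.
apply: tree_idem_glb => //; first by exists (vpath (path_tgt g)).
move=> t Tt; have [rt ts] := Tp _ Tt.
have [rgt sgt tgt_] := path_mulP (proj1 rg) (proj1 rt) (esym ts).
have [ig tg] := path_invP (proj1 rg).
have le : nle ((path_elt g)^-1 * tree_idem (translate g T) * path_elt g)
    (((path_elt g)^-1 * path_elt (path_mul g t)) *
     ((path_elt g)^-1 * path_elt (path_mul g t))^-1).
  rewrite isg_invM // isg_invK // !isgA //; apply: nle_mulr => //.
  rewrite -isgA //; apply: nle_mull => //.
  by apply: tree_idem_le => //; exists t.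
apply: (nle_trans SP le); apply: nle_ran => //.
rewrite -path_elt_inv; last by case: rg.
rewrite -[in X in nle _ X](path_mulVK rt (proj1 rg) (esym ts)).
apply: path_elt_mul; [exact: rpath_inv|by case: rgt|by rewrite tg sgt].
Qed.

Lemma path_elt_tree g T : rpath g -> subtree (path_tgt g) T ->
  path_elt g * tree_idem T = tree_idem (translate g T) * path_elt g.
Proof.
move=> rg sT; rewrite -tree_idem_translate //.
by apply: isg_mul_idem => //; exact: tree_idem_idem.
Qed.

Lemma tree_idem_absorb T g : finite_set T -> T g ->
  tree_idem T * path_idem g = tree_idem T.
Proof.
by move=> Tf Tg; apply: nle_idem => //; [exact: path_idemP|exact: tree_idem_le].
Qed.

(** The idempotent of [g1 * T2] lies below the range of
    [path_elt g1 * path_elt g2], and below it that product agrees with the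
    element of the reduced path. *)
Lemma munn_elt_mul T1 g1 T2 g2 : rpath g1 ->
  finite_set T1 -> T1 !=set0 ->
  subtree (path_tgt g1) T2 -> T2 g2 ->
  tree_idem T1 * path_elt g1 * (tree_idem T2 * path_elt g2) =
  tree_idem (T1 `|` translate g1 T2) * path_elt (path_mul g1 g2).
Proof.
move=> rg1 T1f T10 sT2 T2g.
have [gTf gTg _] := subtree_translate rg1 erefl sT2.
have [T2f _ _ /(_ _ T2g)[rg2 g2s]] := sT2.
rewrite isgA // -(isgA SP _ (path_elt g1)) path_elt_tree //.
rewrite tree_idemU //; last by exists g1.
rewrite -!(isgA SP); congr (_ * _).
have le := path_elt_mul rg1 (proj1 rg2) (esym g2s).
set s := path_elt g1 * path_elt g2 in le *.
have ss : tree_idem (translate g1 T2) * (s * s^-1) = tree_idem (translate g1 T2).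
  apply: nle_idem => //; first exact: isg_idemV.
  rewrite -tree_idem_translate // /s isg_invM // !isgA //; apply: nle_mulr => //.
  by rewrite -isgA //; apply: nle_mull => //; exact: tree_idem_le.
by rewrite (nleE SP le) isgA // ss.
Qed.

Lemma munn_elt_inv T g : rpath g -> subtree (path_src g) T ->
  (tree_idem T * path_elt g)^-1 =
  tree_idem (translate (path_inv g) T) * path_elt (path_inv g).
Proof.
move=> rg sT; have [ig tg] := path_invP (proj1 rg).
rewrite isg_invM // (isg_inv_idem SP (tree_idem_idem T)).
rewrite -(path_elt_inv (proj1 rg)).
by rewrite path_elt_tree //; [exact: rpath_inv|rewrite tg].
Qed.

Lemma path_idem_src p q :
  path_src p <> path_src q -> path_idem p * path_idem q = 0.
Proof.
move=> pq; rewrite /path_idem -(path_elt_src p) -(path_elt_src q).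
rewrite (isg_invM SP _ (path_elt p)) rep_vV !isgA //.
rewrite -(isgA SP _ (f (inl (path_src p)))) rep_vw //.
by rewrite isgx0 // !isg0x.
Qed.

(** A product of incompatible path idempotents contains the element of a path
    that is not separated. *)
Lemma path_idem_incompat v p q : rpath p -> rpath q ->
  path_src p = v -> path_src q = v -> ~ compat v p q ->
  path_idem p * path_idem q = 0.
Proof.
move=> rp rq pv qv ncmp.
have [iq tq] := path_invP (proj1 rq).
have tqp : path_tgt (path_inv q) = path_src p by rewrite tq pv qv.
have := path_elt_mul (rpath_inv rq) (proj1 rp) tqp.
have [rm _ _] := path_mulP iq (proj1 rp) tqp.
have -> : path_elt (path_mul (path_inv q) p) = 0.
  by apply: path_elt0 => // sp; apply: ncmp; exact: Or33.
move=> /(nle0 SP); rewrite (path_elt_inv (proj1 rq)) => z.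
rewrite isg_idemC //; [|exact: path_idemP|exact: path_idemP].
rewrite /path_idem isgA // -(isgA SP (path_elt q)).
by rewrite z isgx0 // isg0x.
Qed.

(** The relations [e^-1 * f = 0] kill the idempotent of every tree that is not
    compatible. *)
Lemma tree_idem0 v U : finite_set U ->
  (forall p, U p -> rpath p /\ path_src p = v) ->
  ~ compatible_at v U -> tree_idem U = 0.
Proof.
move=> Uf Up ncmp; apply: contrapT => U0; apply: ncmp.
have le2 p q : U p -> U q -> path_idem p * path_idem q <> 0.
  move=> pU qU pq; apply: U0; rewrite -tree_idem_idem; apply: (nle0 SP).
  by rewrite -pq; apply: nle_mul => //; exact: tree_idem_le.
split.
  move=> p pU; have [rp pv] := Up _ pU; split=> //; apply: contrapT => ns.
  by apply: (le2 p p pU pU); rewrite /path_idem path_elt0 // !isg0x.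
move=> p q pU qU; have [rp pv] := Up _ pU; have [rq qv] := Up _ qU.
by apply: contrapT => /(path_idem_incompat rp rq pv qv); exact: le2.
Qed.

End Representation.

Lemma hom_path_elt (E : sepgraph) (S S' : isg0) (F : S -> S')
    (f : vertex E + hedge E -> S) (f' : vertex E + hedge E -> S') :
  isg0_hom F -> (forall a, F (f a) = f' a) ->
  forall p, F (path_elt f p) = path_elt f' p.
Proof.
move=> [FM _ _] Ff [v]; elim/last_ind => [|w x ih]; first exact: Ff.
by rewrite !path_elt_rcons FM ih Ff.
Qed.

Lemma hom_tree_idem (E : sepgraph) (S S' : isg0) (F : S -> S')
    (f : vertex E + hedge E -> S) (f' : vertex E + hedge E -> S') :
  isg0_hom F -> (forall a, F (f a) = f' a) ->
  forall T, F (tree_idem f T) = tree_idem f' T.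
Proof.
move=> Fh Ff T; have [FM FV F0] := Fh; rewrite /tree_idem.
have Fi p : F (path_idem f p) = path_idem f' p.
  by rewrite /path_idem FM FV !(hom_path_elt Fh Ff).
case: (enum_fset _) => //= p ps; elim: ps => //= q ps ih.
by rewrite FM Fi ih.
Qed.

(** * The symmetric inverse monoid *)

Section PartialInjections.
Variable U : Type.

Record pinj := Pinj {
  pinj_rel :> U -> U -> Prop;
  pinj_fun : forall x y z, pinj_rel x y -> pinj_rel x z -> y = z;
  pinj_inj : forall x y z, pinj_rel x z -> pinj_rel y z -> x = y }.

Lemma pinj_ext (r s : pinj) : (forall x y, r x y <-> s x y) -> r = s.
Proof.
case: r s => [r rf ri] [s sf si] /= rs.
have e : r = s by apply/funext => x; apply/funext => y; apply/propext.
by subst s; congr Pinj; exact: Prop_irrelevance.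
Qed.

Definition pinj_mul_rel (r s : pinj) x z := exists2 y, r x y & s y z.

Lemma pinj_mul_fun (r s : pinj) x y z :
  pinj_mul_rel r s x y -> pinj_mul_rel r s x z -> y = z.
Proof.
move=> [a xa ay] [b xb bz]; apply: pinj_fun ay _.
by rewrite (pinj_fun xa xb).
Qed.

Lemma pinj_mul_inj (r s : pinj) x y z :
  pinj_mul_rel r s x z -> pinj_mul_rel r s y z -> x = y.
Proof.
move=> [a xa az] [b yb bz]; apply: pinj_inj xa _.
by rewrite (pinj_inj az bz).
Qed.

Definition pinj_mul r s := Pinj (@pinj_mul_fun r s) (@pinj_mul_inj r s).

Definition pinj_inv (r : pinj) : pinj :=
  @Pinj (fun x y => r y x) (fun x y z => @pinj_inj r y z x)
    (fun x y z => @pinj_fun r z x y).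

Definition pinj_zero : pinj :=
  @Pinj (fun _ _ => False) (fun x y z h => False_ind _ h)
    (fun x y z h => False_ind _ h).

Definition pinj_isg : isg0 := {| isg_car := pinj; isg_mul := pinj_mul;
  isg_inv := pinj_inv; isg_zero := pinj_zero |}.

Lemma pinj_inverse_semigroup0 : inverse_semigroup0 pinj_isg.
Proof.
split=> [r s t|r|r|r s].
- apply: pinj_ext => x y; split.
    by move=> [a xa [b ab bz]]; exists b => //; exists a.
  by move=> [b [a xa ab] bz]; exists a => //; exists b.
- by apply: pinj_ext => x y; split=> // -[].
- by apply: pinj_ext => x y; split=> // -[].
split=> [[rsr srs]|->]; last first.
  split; apply: pinj_ext => x y; split.
  - by move=> [a [b xb ab] ay]; rewrite (pinj_inj xb ab).
  - by move=> xy; exists x => //; exists y.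
  - by move=> [a [b bx ba] ya]; rewrite (@pinj_fun r b x a bx ba).
  - by move=> xy; exists x => //; exists y.
apply: pinj_ext => x y; split=> /= [xy|yx].
  have [c [b xb bc] cy] : (s * r * s)%S x y by rewrite srs.
  by rewrite -(pinj_fun xb xy) in bc *; rewrite (pinj_inj xy cy).
have [c [b yb bc] cx] : (r * s * r)%S y x by rewrite rsr.
by rewrite -(pinj_fun yb yx) -(pinj_inj cx yx).
Qed.

End PartialInjections.

(** * Separating trees in the presented inverse semigroup *)

Lemma SEC_inverse_semigroup0 (E : sepgraph) : inverse_semigroup0 (SEC E).
Proof. exact: presented_inverse_semigroup0. Qed.

Definition sec_gen {E : sepgraph} : vertex E + hedge E -> SEC E :=
  pres_gen (@sec_rel E).

Lemma sec_gen_rel (E : sepgraph) (a b : sec_term E) :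
  sec_rel a b -> isg_eval sec_gen a = isg_eval sec_gen b.
Proof. exact: pres_rel. Qed.

Lemma block_src (E : sepgraph) (X : set (edge E)) e f :
  blocks X -> X e -> X f -> src e = src f.
Proof.
move=> [u _ uX] Xe Xf; have [UE _ _] := blockP u.
have h e' : X e' -> src e' = u.
  by move=> Xe'; have : cover (block u) id e' by [exists X]; rewrite UE.
by rewrite (h e) // (h f).
Qed.

Section TreeModel.
Variables (E : sepgraph) (v : vertex E) (T : set (gpath E)).
Hypothesis TX : inX v T.
Implicit Types (h k p q : gpath E) (x : hedge E).

Lemma inX_subtree : subtree v T.
Proof.
have [[p Tp] Tf Tl [TF _]] := TX.
split=> // [|q /TF[/sep_rpath] //].
by apply: (Tl _ _ Tp); case: (TF _ Tp) => _ <-; exact: prefix_vpath.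
Qed.

(** Appending inverse edges to [T] makes each [e^-1] defined wherever a path ends
    at the target of [e], as required for [e^-1 * e] to act as that vertex. *)
Definition saturation : set (gpath E) := [set h | rpath h /\ T (g0 h)].

Lemma saturation_sub p : T p -> saturation p.
Proof.
have [Tf Tl Tv Tp] := inX_subtree => pT; split; first by case: (Tp _ pT).
exact: Tl pT (g0_prefix p).
Qed.

Lemma step_rpath h x : rpath h -> hsrc x = path_tgt h ->
  rpath (path_mul h (hsrc x, [:: x])) /\
  path_tgt (path_mul h (hsrc x, [:: x])) = htgt x.
Proof.
move=> [ih _] xh; have ix : is_path (hsrc x, [:: x]) by [].
by have [? _ ?] := path_mulP ih ix (esym xh).
Qed.

Lemma step_back h x : rpath h ->
  path_mul (path_mul h (hsrc x, [:: x])) (htgt x, [:: linv x]) = h.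
Proof.
case: h => u w [_ rw]; rewrite /path_mul /= red_catl -catA /=.
rewrite -red_catr /=; case: asboolP => // _.
by rewrite cats0 red_id.
Qed.

Lemma step_inj h k x : rpath h -> rpath k ->
  path_mul h (hsrc x, [:: x]) = path_mul k (hsrc x, [:: x]) -> h = k.
Proof. by move=> rh rk e; rewrite -(step_back x rh) -(step_back x rk) e. Qed.

Definition model_rel (a : vertex E + hedge E) h k : Prop :=
  [/\ saturation h, saturation k &
  match a with
  | inl u => path_tgt h = u /\ k = h
  | inr x => path_tgt h = hsrc x /\ k = path_mul h (hsrc x, [:: x])
  end].

Lemma model_rel_fun a h k k' : model_rel a h k -> model_rel a h k' -> k = k'.
Proof. by case: a => a [_ _ [_ ->]] [_ _ [_ ->]]. Qed.

Lemma model_rel_inj a h h' k : model_rel a h k -> model_rel a h' k -> h = h'.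
Proof.
case: a => a [[rh _] _ [_ ->]] [[rh' _] _ [_ e]] //.
by apply: (step_inj rh rh') e.
Qed.

Definition model_gen a : pinj_isg (gpath E) :=
  Pinj (@model_rel_fun a) (@model_rel_inj a).

Lemma saturation_bwd h e : saturation h -> path_tgt h = tgt e ->
  saturation (path_mul h (tgt e, [:: Bwd e])).
Proof.
have [Tf Tl Tv Tp] := inX_subtree.
move=> [rh Th] he; split; first by case: (@step_rpath h (Bwd e)).
case: h rh Th he => u w [_ rw] Th he.
case: (@stepP _ u w (Bwd e) rw) => [w' wE|_].
  apply: Tl Th _; apply: prefix_trans (g0_prefix _) _.
  by rewrite wE /= g0_rcons_fwd; split=> //; exists [:: Fwd e]; rewrite cats1.
by rewrite g0_rcons_bwd.
Qed.

(** Two edges of a block leaving one vertex of the saturation cannot both stay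
    in it: they would give incompatible elements of [T], or a non-separated
    path in [T] if the vertex is reached through the inverse of one of them. *)
Lemma saturation_sep h X e f : blocks X -> X e -> X f ->
  saturation h -> path_tgt h = src e ->
  saturation (path_mul h (src e, [:: Fwd e])) ->
  saturation (path_mul h (src e, [:: Fwd f])) -> e = f.
Proof.
have [Tf Tl Tv Tp] := inX_subtree; have [_ _ _ [TF Tc]] := TX.
move=> bX Xe Xf; case: h => u w [[iw rw] _] he [[ie re] Te] [[if_ rf] Tf'].
have bad a b z : X a -> X b ->
    ~ T (u, rcons (rcons z (Bwd a)) (Fwd b)).
  move=> Xa Xb /TF[[_ _ sp] _]; apply: (sp X z a b [::] bX Xa Xb).
  by rewrite /= -!cats1 -catA.
move: Te Tf'; rewrite /path_mul /= !cats1.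
have := @reduced_rcons _ w (Fwd e) rw; have := @reduced_rcons _ w (Fwd f) rw.
case=> [[z zE]|rwf]; case=> [[z' zE']|rwe].
- by move: zE'; rewrite zE => /rcons_inj[_ ->].
- move: rwe; rewrite zE => rwe; rewrite (red_id rwe) => Te.
  by exfalso; apply: (bad f e z) => //; rewrite g0_rcons_fwd in Te.
- move: rwf; rewrite zE' => rwf _; rewrite (red_id rwf) => Tf'.
  by exfalso; apply: (bad e f z') => //; rewrite g0_rcons_fwd in Tf'.
rewrite !red_id // !g0_rcons_fwd => Te Tf'.
apply: contrapT => ef; have := Tc _ _ Te Tf'; case.
- by move=> [_]; case: (w).
- by move=> [_]; case: (w).
have E1 : path_mul (path_inv (u, rcons w (Fwd f))) (u, rcons w (Fwd e)) =
    (tgt f, [:: Bwd f; Fwd e]).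
  rewrite /path_mul /path_inv path_tgt_rcons /= word_inv_rcons /= -cats1.
  congr pair; rewrite -[LHS]/(cancel_cons (Bwd f) (red _)) catA -red_catl.
  by rewrite red_Vmul /=; case: asboolP => // -[fe]; case: (ef fe).
rewrite E1 => -[_ _ sp].
by apply: (sp X [::] f e [::]).
Qed.

Lemma model_gen_rel (a b : sec_term E) :
  sec_rel a b -> isg_eval model_gen a = isg_eval model_gen b.
Proof.
case=> /= [u|u w uw|x|x|X e bX Xe|X e f bX Xe Xf ef].
- apply: pinj_ext => h k; split; last by move=> [sh sk [hu ->]]; exists h.
  by move=> [l [sh sl [hu ->]] [? ? [? ->]]].
- apply: pinj_ext => h k; split=> // -[l [sh sl [hu ->]] [_ _ [hw _]]].
  by apply: uw; rewrite -hu -hw.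
- apply: pinj_ext => h k; split.
    by move=> [l [sh sl [hu ->]] kl].
  by move=> hk; exists h => //; case: hk => sh _ [? _].
- apply: pinj_ext => h k; split.
    by move=> [l hl [sl sk [_ ->]]].
  move=> hk; exists k => //; case: hk => sh sk [hx kE]; split=> //; split=> //.
  by rewrite kE; case: (@step_rpath h x) => //; case: sh.
- apply: pinj_ext => h k; split.
    move=> [l [sh sl [hx lE]] [_ sk [lx ->]]].
    have E1 := step_back (Bwd e) (proj1 sh).
    by rewrite lE E1.
  move=> [sh _ [he ->]]; have sb := saturation_bwd sh he.
  have [rb tb] := @step_rpath h (Bwd e) (proj1 sh) (esym he).
  exists (path_mul h (tgt e, [:: Bwd e])); split=> //; split=> //.
  exact/esym/(step_back (Bwd e) (proj1 sh)).
- apply: pinj_ext => h k; split=> // -[l [sh sl [hx lE]] [_ sk [lx kE]]].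
  apply: ef; apply: (saturation_sep bX Xe Xf sl).
  + by rewrite lE; case: (@step_rpath h (Bwd e) (proj1 sh) (esym hx)).
  + by have := step_back (Bwd e) (proj1 sh); rewrite /htgt /= -lE => ->.
  + by rewrite (block_src bX Xe Xf) -[src f]/(hsrc (Fwd f)) -kE.
Qed.

Lemma saturation_src h : saturation h -> path_src h = v.
Proof.
have [_ _ _ Tp] := inX_subtree.
by move=> [_ /Tp[_]].
Qed.

Lemma saturation_vpath : saturation (vpath v).
Proof. by apply: saturation_sub; case: inX_subtree. Qed.

Lemma saturation_lower : lower saturation.
Proof.
have [_ Tl _ _] := inX_subtree.
move=> p q [rq Tq] pq; split; first exact: prefix_rpath pq rq.
exact: Tl Tq (prefix_g0 pq).
Qed.

Lemma model_path_elt p k : rpath p ->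
  path_elt model_gen p (vpath v) k <-> saturation p /\ k = p.
Proof.
case: p => u w; elim/last_ind: w k => [|w x ih] k rp.
  split=> [[_ sk [/= <- ->]]|[su ->]]; first by split=> //; exact: saturation_vpath.
  have uv : u = v := saturation_src su.
  by rewrite /path_elt /= uv; split=> //; rewrite -uv.
have rw := rpath_rconsl rp; have [/is_path_rcons[iw xw] rwx] := rp.
have stp : path_mul (u, w) (hsrc x, [:: x]) = (u, rcons w x).
  by rewrite /path_mul /= cats1 red_id.
rewrite path_elt_rcons; split.
  move=> [l /(ih _ rw)[sl ->]] [_ sk [_ kE]].
  by rewrite stp in kE; rewrite -kE.
move=> [sp ->]; have sw : saturation (u, w).
  by apply: (saturation_lower sp); split=> //; exists [:: x]; rewrite cats1.
exists (u, w); first exact/ih.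
by split=> //; split=> //; exact/esym.
Qed.

Lemma model_path_idem p k : rpath p ->
  path_idem model_gen p (vpath v) k <-> saturation p /\ k = vpath v.
Proof.
move=> rp; split.
  move=> [l pl kl]; have [sp lp] := (model_path_elt l rp).1 pl.
  by split=> //; exact: (@pinj_inj _ (path_elt model_gen p) _ _ l).
move=> [sp ->]; exists p; exact/(model_path_elt p rp).
Qed.

Lemma model_tree_idem U k : finite_set U -> U !=set0 ->
  (forall p, U p -> rpath p) ->
  tree_idem model_gen U (vpath v) k <-> U `<=` saturation /\ k = vpath v.
Proof.
move=> Uf [p0 Up0] Ur; rewrite /tree_idem.
have mU p : p \in enum_fset (fset_set U) = (p \in U) by rewrite -in_fset_set.
have -> : (U `<=` saturation) =
    (forall p, p \in enum_fset (fset_set U) -> saturation p).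
  apply/propext; split=> h p; first by rewrite mU inE => /h.
  by move=> Up; apply: h; rewrite mU inE.
have: forall p, p \in enum_fset (fset_set U) -> rpath p.
  by move=> p; rewrite mU inE => /Ur.
have: p0 \in enum_fset (fset_set U) by rewrite mU inE.
case: (enum_fset _) => // p ps _ {mU}.
rewrite /meet_seq; elim: ps k => [|q ps ih] k rps /=.
  apply: (iff_trans (model_path_idem k (rps p _))); first by rewrite inE.
  split=> [[sp ->]|[sp ->]]; split=> //; first by move=> t; rewrite inE => /eqP ->.
  by apply: sp; rewrite inE.
have rps' t : t \in p :: ps -> rpath t.
  by rewrite inE => /orP[tp|tps]; apply: rps; rewrite !inE ?tp ?tps ?orbT.
have rq : rpath q by apply: rps; rewrite !inE eqxx orbT.
split.
  move=> [l /(model_path_idem _ rq)[sq ->] /(ih _ rps')[sps ->]]; split=> //.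
  move=> t; rewrite !inE => /or3P[tp|/eqP -> //|tps].
    by apply: sps; rewrite inE tp.
  by apply: sps; rewrite inE tps orbT.
move=> [sps ->]; exists (vpath v).
  by apply/model_path_idem => //; split=> //; apply: sps; rewrite !inE eqxx orbT.
apply/ih => //; split=> // t; rewrite inE => /orP[tp|tps]; apply: sps.
  by rewrite inE tp.
by rewrite !inE tps !orbT.
Qed.

Lemma model_munn_elt U g k : finite_set U -> U !=set0 ->
  (forall p, U p -> rpath p) -> rpath g ->
  (tree_idem model_gen U * path_elt model_gen g)%S (vpath v) k <->
  [/\ U `<=` saturation, saturation g & k = g].
Proof.
move=> Uf U0 Ur rg; split.
  by move=> [l /(model_tree_idem _ Uf U0 Ur)[sU ->] /(model_path_elt _ rg)[]].
move=> [sU sg ->]; exists (vpath v); first exact/model_tree_idem.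
exact/model_path_elt.
Qed.

Lemma SEC_model : exists2 F : SEC E -> pinj_isg (gpath E), isg0_hom F &
  (forall p, F (path_elt sec_gen p) = path_elt model_gen p) /\
  (forall U, F (tree_idem sec_gen U) = tree_idem model_gen U).
Proof.
have [F [[Fh Fg] _]] :=
  presented_universal (pinj_inverse_semigroup0 (gpath E)) model_gen_rel.
exists F => //; split; first exact: hom_path_elt.
exact: hom_tree_idem.
Qed.

End TreeModel.

(** In the model built on [T], the left-hand element moves the base point to [g],
    while the right-hand one is defined there only if [U] lies in the saturation
    of [T], and then moves it to [h]. *)
Lemma munn_elt_inj (E : sepgraph) v (T U : set (gpath E)) g h :
  inX v T -> saturation T g -> finite_set U -> U !=set0 ->
  (forall p, U p -> rpath p) -> rpath h ->
  (tree_idem sec_gen T * path_elt sec_gen g)%S =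
  (tree_idem sec_gen U * path_elt sec_gen h)%S ->
  g = h /\ U `<=` saturation T.
Proof.
move=> TX sg Uf U0 Ur rh e.
have [F [FM _ _] [Fp Ft]] := SEC_model TX.
have [Tf Tl Tv Tp] := inX_subtree TX.
have: F (tree_idem sec_gen T * path_elt sec_gen g)%S (vpath v) g.
  have T0 : T !=set0 by exists (vpath v).
  have Tr p : T p -> rpath p by move=> /Tp[].
  rewrite FM Ft Fp; apply/(model_munn_elt TX _ Tf T0 Tr (proj1 sg)).
  by split=> // p; exact: (saturation_sub TX).
by rewrite e FM Ft Fp => /(model_munn_elt TX _ Uf U0 Ur rh)[].
Qed.

Lemma munn_elt_neq0 (E : sepgraph) v (T : set (gpath E)) g :
  inX v T -> saturation T g ->
  (tree_idem sec_gen T * path_elt sec_gen g)%S <> 0%S.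
Proof.
move=> TX sg e.
have [F [FM _ F0] [Fp Ft]] := SEC_model TX.
have [Tf Tl Tv Tp] := inX_subtree TX.
have: F (tree_idem sec_gen T * path_elt sec_gen g)%S (vpath v) g.
  have T0 : T !=set0 by exists (vpath v).
  have Tr p : T p -> rpath p by move=> /Tp[].
  rewrite FM Ft Fp; apply/(model_munn_elt TX _ Tf T0 Tr (proj1 sg)).
  by split=> // p; exact: (saturation_sub TX).
by rewrite e F0.
Qed.

(** * Munn trees as normal forms *)

Section MunnTrees.
Variable E : sepgraph.
Local Open Scope isg_scope.
Implicit Types (p q g : gpath E) (T U : set (gpath E)) (t : munn_tree E).

Let SP := SEC_inverse_semigroup0 E.
Let gR := @sec_gen_rel E.

Local Notation P := (path_elt (@sec_gen E)).
Local Notation I := (tree_idem (@sec_gen E)).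

Lemma tree_idem_neq0 v T : inX v T -> I T <> 0.
Proof.
move=> TX IT0; apply: (munn_elt_neq0 TX (saturation_vpath TX)).
by rewrite IT0 isg0x.
Qed.

(** With [tree_idem_neq0], this makes the nonvanishing of [I U] a criterion for
    compatibility. *)
Lemma subtree_inX v U : subtree v U -> I U <> 0 -> inX v U.
Proof.
move=> [Uf Ul Uv Up] IU0; split=> //; first by exists (vpath v).
apply: contrapT => ncmp; apply: IU0; exact: (tree_idem0 SP gR Uf Up).
Qed.

Lemma inX_sub v T U : inX v T -> U `<=` T -> U !=set0 -> lower U -> inX v U.
Proof.
move=> [_ Tf _ [TF Tc]] UT U0 Ul; split=> //; first exact: sub_finite_set Tf.
by split=> [p /UT/TF //|p q /UT Tp /UT Tq]; exact: Tc.
Qed.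

Lemma inX_low0 v T : inX v T -> inX0 v (low0 T).
Proof.
move=> TX; have [_ _ Tl _] := TX; have [_ _ Tv _] := inX_subtree TX.
split; last exact: low0_idem.
apply: (inX_sub TX); [exact: low0_sub|by exists (vpath v); exact: (low0_g0 Tv)|].
exact: lower_low0.
Qed.

Lemma inX_C_compatible v U : subtree v U -> C_compatible U -> inX v U.
Proof.
move=> [Uf Ul Uv Up] [w [UF Uc]]; have [_ vw] := UF _ Uv.
rewrite -[w]vw in UF Uc; split=> //; by exists (vpath v).
Qed.

Definition munn_elt (a : munn0 E) : SEC E :=
  if a is Some t then I (mt_set t) * P (mt_end t) else 0.

Lemma mt_end_rpath t : rpath (mt_end t).
Proof. exact: sep_rpath (mt_endP t). Qed.

Lemma mt_end_saturation t : saturation (mt_set t) (mt_end t).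
Proof. by split; [exact: mt_end_rpath|exact: mt_in]. Qed.

Lemma munn_elt_repr t T : representative (mt_root t) (mt_set t) T ->
  munn_elt (Some t) = I T * P (mt_end t).
Proof.
rewrite /= => -[TX <-]; rewrite (tree_idem_low0 SP gR (inX_subtree TX)) //.
Qed.

Lemma munn_tree_of v T g : inX v T -> T g ->
  exists t, mt_set t = low0 T /\ mt_end t = g.
Proof.
move=> TX Tg; have [_ _ _ [/(_ _ Tg)[sg gv] _]] := TX.
have T0 : inX0 (path_src g) (low0 T) by rewrite gv; exact: inX_low0.
by exists (MunnTree T0 sg (low0_g0 Tg)).
Qed.

Lemma munn_elt_of v T t : inX v T -> mt_set t = low0 T ->
  munn_elt (Some t) = I T * P (mt_end t).
Proof. by move=> TX tT; rewrite /= tT (tree_idem_low0 SP gR (inX_subtree TX)). Qed.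

Lemma munn_tree_ext t t' : mt_set t = mt_set t' -> mt_end t = mt_end t' -> t = t'.
Proof.
case: t t' => [T g a b c] [T' g' a' b' c'] /= e e'; subst T' g'.
by congr MunnTree; exact: Prop_irrelevance.
Qed.

Lemma low0_saturation v T U :
  inX0 v T -> low0 U = U -> U `<=` saturation T -> U `<=` T.
Proof.
move=> [[_ _ Tl _] _] UE US p; rewrite -UE => -[q /US[_ Tq] pq].
exact: Tl Tq pq.
Qed.

Lemma munn_elt_Some_neq0 t : munn_elt (Some t) <> 0.
Proof.
have [tX _] := mt_setP t.
exact: (munn_elt_neq0 tX (mt_end_saturation t)).
Qed.

Lemma munn_elt_injective : injective munn_elt.
Proof.
have half t t' : munn_elt (Some t) = munn_elt (Some t') ->
    mt_end t = mt_end t' /\ mt_set t' `<=` mt_set t.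
  move=> e; have [tX _] := mt_setP t; have [t'X t'0] := mt_setP t'.
  have [Uf _ Uv Up] := inX_subtree t'X.
  have [||ee sub] := munn_elt_inj tX (mt_end_saturation t) Uf _ _ (mt_end_rpath t') e.
  - by exists (vpath (mt_root t')).
  - by move=> p /Up[].
  - by split=> //; exact: low0_saturation (mt_setP t) t'0 sub.
move=> [t|] [t'|] // e; last first.
- by case: (munn_elt_Some_neq0 (esym e)).
- by case: (munn_elt_Some_neq0 e).
have [ee s1] := half _ _ e; have [_ s2] := half _ _ (esym e).
by congr Some; apply: munn_tree_ext => //; apply/seteqP.
Qed.

Lemma low0U T U : low0 (T `|` U) = low0 T `|` low0 U.
Proof.
apply/seteqP; split=> p.
  by move=> [g [Tg|Ug] pg]; [left|right]; exists g.
by move=> [[g Tg pg]|[g Ug pg]]; exists g => //; [left|right].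
Qed.

(** The hull of [T] and [g] has the same idempotent as [T], because [g] and
    [g0 g] have the same range; this idempotent being nonzero, the hull is
    compatible. *)
Lemma representative_exists t :
  exists2 T', representative (mt_root t) (mt_set t) T' & T' (mt_end t).
Proof.
have [tX t0] := mt_setP t; have [Tf Tl Tv Tp] := inX_subtree tX.
have rg := mt_end_rpath t; have gT := mt_in t.
set g := mt_end t in tX Tv Tp rg gT *; set T := mt_set t in tX t0 Tf Tl Tv Tp gT *.
exists (T `|` down g); last by right; exact: prefix_refl.
split; last first.
  rewrite low0U t0; apply/seteqP; split=> p; last by left.
  by move=> [//|[q qg pq]]; apply: Tl gT _; apply: prefix_trans pq (prefix_g0 qg).
apply: subtree_inX.
  split; first by rewrite finite_setU; split=> //; exact: finite_down.
  - move=> p q [Tq|gq] pq; [left; exact: Tl Tq pq|right; exact: lower_down gq pq].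
  - by left.
  - move=> p [/Tp//|pg]; split; [exact: prefix_rpath pg rg|by case: pg].
have gg : down g g by exact: prefix_refl.
rewrite tree_idemU //; [|exact: finite_down|by exists (g0 g)|by exists g].
rewrite (tree_idem_down _ SP) -(path_idem_g0 SP gR (proj1 rg)).
by rewrite (tree_idem_absorb _ SP Tf gT); exact: tree_idem_neq0 tX.
Qed.

Lemma subtree_mul v T1 g1 T2 : subtree v T1 -> T1 g1 ->
  subtree (path_tgt g1) T2 -> subtree v (T1 `|` translate g1 T2).
Proof.
move=> [T1f T1l T1v T1p] T1g sT2; have [rg gv] := T1p _ T1g.
have [T2f T2l T2v T2p] := sT2.
have [gTf _ gTp] := subtree_translate rg gv sT2.
split; [by rewrite finite_setU| |by left|].
- move=> p q [T1q|[t T2t <-]] pq; first by left; exact: T1l T1q pq.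
  have [rt tv] := T2p _ T2t.
  have [pg|[s st ->]] := prefix_mul rg rt (esym tv) pq.
    by left; exact: T1l T1g pg.
  by right; exists s => //; exact: T2l T2t st.
- by move=> p [/T1p|/gTp].
Qed.

Lemma path_mul_prefix_inv g q : rpath g -> prefix_le q (path_inv g) ->
  prefix_le (path_mul g q) g.
Proof.
case: g q => v w [u z] [iw rw] [/= uE [r wE]]; split=> //.
have wE' : w = word_inv r ++ word_inv z by rewrite -word_inv_cat -wE word_invK.
exists (word_inv z); rewrite /= {1}wE' wE' -catA -red_catr red_Vmul cats0.
by rewrite red_id //; move: rw; rewrite wE' => /reduced_catl.
Qed.

Lemma subtree_inv g T : subtree (path_src g) T -> T g ->
  subtree (path_tgt g) (translate (path_inv g) T).
Proof.
move=> sT Tg; have [Tf Tl Tv Tp] := sT; have [rg _] := Tp _ Tg.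
have [ig tg] := path_invP (proj1 rg); have rig := rpath_inv rg.
have sT' : subtree (path_tgt (path_inv g)) T by rewrite tg.
have [gTf _ gTp] := @subtree_translate _ _ (path_tgt g) _ rig erefl sT'.
split=> //; last by exists g => //; exact: path_mulVg.
move=> q _ [t Tt <-] qt; have [rt tv] := Tp _ Tt.
have [qg|[s st ->]] := prefix_mul rig rt (etrans tg (esym tv)) qt; last first.
  by exists s => //; exact: Tl Tt st.
exists (path_mul g q); first exact: Tl Tg (path_mul_prefix_inv rg qg).
apply: path_mulVK; [exact: prefix_rpath qg rig|by case: rg|by case: qg].
Qed.

Lemma munn_elt_prod t1 t2 T1 T2 :
  representative (mt_root t1) (mt_set t1) T1 -> T1 (mt_end t1) ->
  representative (mt_root t2) (mt_set t2) T2 -> T2 (mt_end t2) ->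
  let U := T1 `|` translate (mt_end t1) T2 in
  let nonzero := path_tgt (mt_end t1) = mt_root t2 /\ C_compatible U in
  (nonzero -> exists t,
    [/\ munn_elt (Some t1) * munn_elt (Some t2) = munn_elt (Some t),
     mt_set t = low0 U & mt_end t = path_mul (mt_end t1) (mt_end t2)]) /\
  (~ nonzero -> munn_elt (Some t1) * munn_elt (Some t2) = 0).
Proof.
move=> r1 T1g r2 T2g U nonzero; rewrite (munn_elt_repr r1) (munn_elt_repr r2).
have s1 := inX_subtree (proj1 r1); have s2 := inX_subtree (proj1 r2).
have rg := mt_end_rpath t1; have [T1f _ T1v _] := s1.
have T10 : T1 !=set0 by exists (mt_end t1).
have [e12|ne12] := pselect (path_tgt (mt_end t1) = mt_root t2); last first.
  split=> [[]//|_].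
  rewrite -(path_elt_tgt SP gR (mt_end t1)).
  have [T2f _ T2v _] := s2.
  have v2 : sec_gen (inl (mt_root t2)) * I T2 = I T2.
    rewrite -(path_idem_vpath SP gR).
    rewrite (isg_idemC SP (path_idemP _ SP _) (tree_idem_idem _ SP _)).
    exact: tree_idem_absorb.
  rewrite -v2 !(isgA SP) -(isgA SP _ (sec_gen (inl (path_tgt _)))).
  rewrite (rep_vw gR ne12).
  by rewrite isgx0 // !isg0x.
rewrite -e12 in s2.
rewrite munn_elt_mul //; rewrite -/U.
have sU : subtree (mt_root t1) U by exact: subtree_mul.
split=> [[_ /(inX_C_compatible sU) UX]|nz]; last first.
  suff -> : I U = 0 by rewrite isg0x.
  apply: contrapT => /(subtree_inX sU)[_ _ _ Uc]; apply: nz; split=> //.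
  by exists (mt_root t1).
have Ug : U (path_mul (mt_end t1) (mt_end t2)) by right; exists (mt_end t2).
have [t [tU tg]] := munn_tree_of UX Ug.
by exists t; split=> //; rewrite (munn_elt_of UX tU) tg.
Qed.

Lemma munn_elt_invE t T :
  representative (mt_root t) (mt_set t) T -> T (mt_end t) ->
  exists t', [/\ (munn_elt (Some t))^-1 = munn_elt (Some t'),
    mt_set t' = low0 (translate (path_inv (mt_end t)) T) &
    mt_end t' = path_inv (mt_end t)].
Proof.
move=> r Tg; have sT := inX_subtree (proj1 r); have rg := mt_end_rpath t.
have e : (munn_elt (Some t))^-1 =
    I (translate (path_inv (mt_end t)) T) * P (path_inv (mt_end t)).
  by rewrite (munn_elt_repr r) munn_elt_inv.
have UX : inX (path_tgt (mt_end t)) (translate (path_inv (mt_end t)) T).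
  apply: subtree_inX; first exact: subtree_inv.
  move=> U0; rewrite U0 isg0x // in e.
  apply: (@munn_elt_Some_neq0 t).
  by rewrite -[LHS](isg_invK SP) e isg_inv0.
have Ug : translate (path_inv (mt_end t)) T (path_inv (mt_end t)).
  have [_ _ Tv _] := sT; exists (vpath (mt_root t)) => //.
  by apply: path_mulg1; exact: rpath_inv.
have [t' [tU tg]] := munn_tree_of UX Ug.
by exists t'; split=> //; rewrite (munn_elt_of UX tU) tg.
Qed.

Lemma munn_elt_mul_ex a b : exists c, munn_elt a * munn_elt b = munn_elt c.
Proof.
case: a => [t1|]; last by exists None; rewrite isg0x.
case: b => [t2|]; last by exists None; rewrite isgx0.
have [T1 r1 T1g] := representative_exists t1.
have [T2 r2 T2g] := representative_exists t2.
have [h1 h2] := munn_elt_prod r1 T1g r2 T2g.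
have [/h1[t [-> _ _]]|/h2 ->] := pselect (path_tgt (mt_end t1) = mt_root t2 /\
    C_compatible (T1 `|` translate (mt_end t1) T2)); first by exists (Some t).
by exists None.
Qed.

Lemma munn_elt_inv_ex a : exists c, (munn_elt a)^-1 = munn_elt c.
Proof.
case: a => [t|]; last by exists None; exact: isg_inv0.
have [T r Tg] := representative_exists t.
by have [t' [-> _ _]] := munn_elt_invE r Tg; exists (Some t').
Qed.

Lemma subtree_down g : rpath g -> subtree (path_src g) (down g).
Proof.
move=> rg; split; [exact: finite_down|exact: lower_down|exact: prefix_vpath|].
by move=> p pg; split; [exact: prefix_rpath pg rg|case: pg].
Qed.

Lemma munn_elt_path g : rpath g -> exists a, P g = munn_elt a.
Proof.
move=> rg; have [g0|g0] := pselect (P g = 0); first by exists None.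
have gg : down g g by exact: prefix_refl.
have gX : inX (path_src g) (down g).
  apply: subtree_inX; first exact: subtree_down.
  by rewrite (tree_idem_down _ SP) => /(isg_ran0 SP).
have [t [tT tg]] := munn_tree_of gX gg.
exists (Some t); rewrite (munn_elt_of gX tT) tg (tree_idem_down _ SP).
by rewrite /path_idem isgK.
Qed.

(** The normal forms contain the generators, which are path elements, and are
    closed under the operations. *)
Lemma munn_elt_onto s : exists a, munn_elt a = s.
Proof.
rewrite -(pres_classK s); elim: (repr _) => [|[v|x]|a [a' aE] b [b' bE]|a [a' aE]].
- by exists None.
- by have [a aE] := munn_elt_path (rpath_vpath v); exists a; rewrite -aE.
- have rx : rpath (hsrc x, [:: x]) by split=> // -[|? [|? ?]].
  have [a aE] := munn_elt_path rx; exists a; rewrite -aE /path_elt /=.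
  exact: (rep_src gR x).
- have [c cE] := munn_elt_mul_ex a' b'; exists c.
  by rewrite -cE aE bE pres_mulE.
- have [c cE] := munn_elt_inv_ex a'; exists c.
  by rewrite -cE aE pres_invE.
Qed.

End MunnTrees.

(** * The semilattice of idempotents *)

Section Idempotents.
Variable E : sepgraph.
Local Open Scope isg_scope.
Implicit Types (p q g : gpath E) (T U : set (gpath E)) (t : munn_tree E)
  (a b : Xcar E).

Let SP := SEC_inverse_semigroup0 E.
Let gR := @sec_gen_rel E.

Local Notation P := (path_elt (@sec_gen E)).
Local Notation I := (tree_idem (@sec_gen E)).

Lemma Xmeet_toX2 T U : T !=set0 -> finite_set T -> lower T ->
  U !=set0 -> finite_set U -> lower U ->
  Xmeet (toX T) (toX U) = toX (T `|` U).
Proof.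
move=> T0 Tf Tl U0 Uf Ul.
case UE : (toX U) => [B|].
  have <- : sval B = U by move: UE; rewrite /toX; case: pselect => // h [<-].
  exact: Xmeet_toX.
rewrite XmeetC Xmeet0 {1}/toX; case: pselect => // -[v TUX].
have UX : inX v U by apply: (inX_sub TUX) => // p Up; right.
by have [h] := toX_Some UX; rewrite UE.
Qed.

Lemma tree_idem_root v T : inX v T -> I T * P (vpath v) = I T.
Proof.
move=> /inX_subtree[Tf _ Tv _].
have -> : P (vpath v) = path_idem sec_gen (vpath v).
  by rewrite (path_idem_vpath SP gR).
exact: tree_idem_absorb.
Qed.

Definition Xidem a : SEC E := if a is Some A then I (sval A) else 0.

(** A tree that is not compatible is sent to zero on both sides. *)
Lemma Xidem_toX v U : subtree v U -> Xidem (toX U) = I U.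
Proof.
move=> sU; rewrite /toX; case: pselect => // h /=.
by apply: contrapT => /nesym U0; apply: h; exists v; exact: subtree_inX.
Qed.

Lemma Xidem_meet a b : Xidem (Xmeet a b) = Xidem a * Xidem b.
Proof.
case: a => [[A [v AX]]|]; last by rewrite isg0x.
case: b => [[B [w BX]]|]; last by rewrite isgx0.
have sA := inX_subtree AX; have sB := inX_subtree BX.
have [Af Al Av Ap] := sA; have [Bf Bl Bw Bp] := sB.
have A0 := subtree_neq0 sA; have B0 := subtree_neq0 sB.
have [vw|vw] := pselect (v = w).
  subst w; rewrite -[LHS]/(Xidem (toX (A `|` B))) (@Xidem_toX v) ?tree_idemU //.
  split; [by rewrite finite_setU| |by left|by move=> p [/Ap|/Bp]].
  by move=> p q [Aq|Bq] pq; [left; exact: Al Aq pq|right; exact: Bl Bq pq].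
have -> : Xidem (Some (exist _ A (ex_intro _ v AX))) *
    Xidem (Some (exist _ B (ex_intro _ w BX))) = 0.
  rewrite -[LHS]/(I A * I B) -(tree_idem_absorb _ SP Bf Bw).
  rewrite (isg_idemC SP (tree_idem_idem _ SP _) (path_idemP _ SP _)).
  rewrite -(tree_idem_absorb _ SP Af Av) -(isgA SP (I A)) (isgA SP (path_idem _ _)).
  by rewrite (path_idem_src SP gR) // isg0x // isgx0.
rewrite -[LHS]/(Xidem (toX (A `|` B))) /toX; case: pselect => // h; exfalso; apply: vw.
have [u [_ _ _ [F _]]] := h.
have [_ vu] := F _ (or_introl Av); have [_ wu] := F _ (or_intror Bw).
exact: etrans vu (esym wu).
Qed.

Lemma Xidem_cong a b : Ycong a b -> Xidem a = Xidem b.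
Proof.
elim=> {a b} //; last first.
- by move=> a a' b b' _ ea _ eb; rewrite !Xidem_meet ea eb.
- by move=> a b c _ -> _ ->.
move=> [v w] e sg ge rge; have rg := sep_rpath sg.
have rgx : rpath (v, rcons w (Bwd e)).
  by split=> //; apply/is_path_rcons; split; [case: rg|rewrite ge].
rewrite (Xidem_toX (subtree_down rg)) (Xidem_toX (subtree_down rgx)).
rewrite !(tree_idem_down _ SP) (path_idem_bwd SP gR) //.
by case: rgx.
Qed.

Lemma Ycong_down_g0 g : sep_path g -> Ycong (toX (down g)) (toX (down (g0 g))).
Proof.
case: g => v; elim/last_ind => [|w [e|e] ih] sg; first exact: Y_refl.
  by rewrite g0_rcons_fwd; exact: Y_refl.
rewrite g0_rcons_bwd.
have sw : sep_path (v, w).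
  by apply: sep_path_prefix sg; split=> //; exists [:: Bwd e]; rewrite cats1.
apply: Y_trans (ih sw); apply: Y_sym; apply: (@Y_gen _ (v, w)) => //.
  by case: sg => /is_path_rcons[_ <-].
by case: sg.
Qed.

(** A finite lower set is the meet of the chains below its points, and the
    congruence allows each chain to be cut at [g0 p]. *)
Lemma Ycong_hull (s : seq (gpath E)) : s <> [::] ->
  (forall p, p \in s -> sep_path p) ->
  Ycong (toX [set q | exists2 p, p \in s & prefix_le q p])
    (toX [set q | exists2 p, p \in s & prefix_le q (g0 p)]).
Proof.
pose hull (k : gpath E -> gpath E) (s : seq (gpath E)) :=
  [set q | exists2 p, p \in s & prefix_le q (k p)].
have hullP k p s' : [/\ hull k (p :: s') !=set0, finite_set (hull k (p :: s')) &
    lower (hull k (p :: s'))].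
  split; first by exists (k p); exists p; [rewrite inE eqxx|exact: prefix_refl].
  - elim: s' p => [|r s' ih] p.
      apply: (@sub_finite_set _ _ (down (k p))); last exact: finite_down.
      by move=> q [t]; rewrite inE => /eqP ->.
    apply: (@sub_finite_set _ _ (down (k p) `|` hull k (r :: s'))).
      by move=> q [t]; rewrite inE => /orP[/eqP ->|ts] qt; [left|right; exists t].
    by rewrite finite_setU; split; [exact: finite_down|exact: ih].
  - by move=> q q' [t ts q't] qq'; exists t => //; exact: prefix_trans qq' q't.
have hull1 k p : hull k [:: p] = down (k p).
  apply/seteqP; split=> q; first by move=> [t]; rewrite inE => /eqP ->.
  by exists p; rewrite ?inE.
have hullS k p r s' : toX (hull k [:: p, r & s']) =
    Xmeet (toX (down (k p))) (toX (hull k (r :: s'))).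
  rewrite Xmeet_toX2; try (by case: (hullP k r s')); last 3 first.
  - by exists (k p); exact: prefix_refl.
  - exact: finite_down.
  - exact: lower_down.
  congr toX; apply/seteqP; split=> q.
    by move=> [t]; rewrite inE => /orP[/eqP ->|ts] qt; [left|right; exists t].
  move=> [qp|[t ts qt]]; first by exists p => //; rewrite inE eqxx.
  by exists t => //; rewrite inE ts orbT.
case: s => // p s _; rewrite -/(hull id (p :: s)) -/(hull (@g0 E) (p :: s)).
elim: s p => [|r s ih] p sp.
  by rewrite !hull1; apply: Ycong_down_g0; apply: sp; rewrite inE.
rewrite !hullS; apply: Y_meet.
  by apply: Ycong_down_g0; apply: sp; rewrite inE eqxx.
by apply: ih => q qs; apply: sp; rewrite inE qs orbT.
Qed.

Lemma Ycong_low0 v T : inX v T -> Ycong (toX T) (toX (low0 T)).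
Proof.
move=> [[p0 Tp0] Tf Tl [TF _]].
have mT p : p \in enum_fset (fset_set T) = (p \in T) by rewrite -in_fset_set.
have -> : T = [set q | exists2 p, p \in enum_fset (fset_set T) & prefix_le q p].
  apply/seteqP; split=> q.
    by move=> Tq; exists q; [rewrite mT inE|exact: prefix_refl].
  by move=> [p]; rewrite mT inE => Tp; exact: Tl.
have -> : low0 [set q | exists2 p, p \in enum_fset (fset_set T) & prefix_le q p] =
    [set q | exists2 p, p \in enum_fset (fset_set T) & prefix_le q (g0 p)].
  apply/seteqP; split=> q; last first.
    by move=> [p pT qp]; exists p => //; exists p => //; exact: prefix_refl.
  move=> [r [p pT rp] qr]; exists p => //.
  exact: prefix_trans qr (prefix_g0 rp).
apply: Ycong_hull; last by move=> p; rewrite mT inE => /TF[].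
by move=> s0; have := mT p0; rewrite s0 in_nil => /esym/negP; apply; rewrite inE.
Qed.

(** The idempotent determines the tree up to its final inverse edges, and these
    are invisible to the congruence. *)
Lemma Xidem_inj a b : Xidem a = Xidem b -> Ycong a b.
Proof.
case: a b => [A|] [B|] //=; last first.
- by move=> _; exact: Y_refl.
- by case: B => B [w BX] /= /esym/(tree_idem_neq0 BX).
- by case: A => A [v AX] /= /(tree_idem_neq0 AX).
case: A B => [A [v AX]] [B [w BX]] /= e.
have half v1 v2 T U : inX v1 T -> inX v2 U -> I T = I U ->
    v1 = v2 /\ low0 T `<=` low0 U.
  move=> TX UX {}e; have [UX0 _] := inX_low0 UX.
  have sT := inX_subtree TX; have sU := inX_subtree UX.
  have [Tf Tl Tv Tp] := sT; have [Uf _ Uv _] := inX_subtree UX0.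
  have e1 : I (low0 U) * P (vpath v2) = I T * P (vpath v1).
    rewrite (tree_idem_low0 SP gR sU) -e.
    by rewrite (tree_idem_root TX) {1}e (tree_idem_root UX) e.
  have [||vv TU] := munn_elt_inj UX0 (saturation_vpath UX0) Tf _ _ (rpath_vpath v1) e1.
  - by exists (vpath v1).
  - by move=> p /Tp[].
  - split; first by case: vv.
    move=> p [q Tq pq]; have [_ Uq] := TU _ Tq.
    by apply: lower_low0 Uq pq.
have [vw AB] := half _ _ _ _ AX BX e; have [_ BA] := half _ _ _ _ BX AX (esym e).
have E1 := Ycong_low0 AX; have E2 := Ycong_low0 BX.
rewrite (_ : low0 A = low0 B) in E1; last exact/seteqP.
have [hA eA] := toX_Some AX; have [hB eB] := toX_Some BX.
rewrite eA in E1; rewrite eB in E2.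
rewrite (Prop_irrelevance (ex_intro _ v AX) hA) (Prop_irrelevance (ex_intro _ w BX) hB).
exact: Y_trans E1 (Y_sym E2).
Qed.

Local Notation Ycar := {eq_quot (@Yequiv E)}.

Definition Yidem (y : Ylat E) : SEC E := Xidem (repr (y : Ycar)).

Lemma Yidem_pi a : Yidem (\pi_Ycar a) = Xidem a.
Proof.
by apply: Xidem_cong; apply/asboolP/(@eqquotP _ (@Yequiv E)); exact: reprK.
Qed.

Lemma Yidem_class v T : subtree v T -> Yidem (Yclass T) = I T.
Proof. by move=> sT; rewrite /Yclass Yidem_pi (Xidem_toX sT). Qed.

Lemma Yidem_inj : injective Yidem.
Proof.
move=> y z /Xidem_inj yz; rewrite -[y](@reprK _ Ycar) -[z](@reprK _ Ycar).
by apply/(@eqquotP _ (@Yequiv E))/asboolP.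
Qed.

Lemma munn_elt_vpath t : mt_end t = vpath (mt_root t) ->
  munn_elt (Some t) = I (mt_set t).
Proof.
move=> tv; have [tX _] := mt_setP t.
by rewrite -[LHS]/(I (mt_set t) * P (mt_end t)) tv (tree_idem_root tX).
Qed.

End Idempotents.

(** * The normal form isomorphism and the degree map *)

Section NormalForm.
Variable E : sepgraph.
Local Open Scope isg_scope.
Implicit Types (p q g : gpath E) (T U : set (gpath E)) (t : munn_tree E)
  (a b : munn0 E) (s : SEC E).

Let SP := SEC_inverse_semigroup0 E.
Let gR := @sec_gen_rel E.

Local Notation P := (path_elt (@sec_gen E)).
Local Notation I := (tree_idem (@sec_gen E)).

Definition normal_form s : munn0 E := sval (cid (munn_elt_onto s)).

Lemma normal_formK s : munn_elt (normal_form s) = s.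
Proof. by rewrite /normal_form; case: cid. Qed.

Lemma munn_eltK a : normal_form (munn_elt a) = a.
Proof. by apply: munn_elt_injective; rewrite normal_formK. Qed.

Lemma normal_form0 : normal_form 0 = None.
Proof. exact: (munn_eltK None). Qed.

Lemma normal_form_neq0 s : s <> 0 -> exists t, normal_form s = Some t.
Proof.
move=> s0; case e : (normal_form s) => [t|]; first by exists t.
by case: s0; rewrite -(normal_formK s) e.
Qed.

(** Transporting the operations through the normal form gives associativity and
    uniqueness of inverses for free, and the explicit formulas become
    identities between elements of the semigroup. *)
Definition munn_mul a b : munn0 E := normal_form (munn_elt a * munn_elt b).
Definition munn_inv a : munn0 E := normal_form ((munn_elt a)^-1).

Lemma normal_form_iso : isg0_iso (normal_form : SEC E -> munn munn_mul munn_inv).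
Proof.
split; last by exists (@munn_elt E); [exact: normal_formK|exact: munn_eltK].
split=> [s s'|s|]; last exact: normal_form0.
- by rewrite /= /munn_mul !normal_formK.
- by rewrite /= /munn_inv normal_formK.
Qed.

Lemma munn_inverse_semigroup0 : inverse_semigroup0 (munn munn_mul munn_inv).
Proof.
have inj := @munn_elt_injective E.
have eM (a b : munn munn_mul munn_inv) :
    munn_elt (a * b)%S = munn_elt a * munn_elt b by exact: normal_formK.
have eV (a : munn munn_mul munn_inv) : munn_elt (a^-1)%S = (munn_elt a)^-1.
  exact: normal_formK.
split.
- by move=> a b c; apply: inj; rewrite !eM isgA.
- by move=> a; apply: inj; rewrite eM isg0x.
- by move=> a; apply: inj; rewrite eM isgx0.
move=> a b; split=> [[aba bab]|->].
  apply: inj; rewrite eV; apply: isg_uniq => //.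
    by rewrite -!eM aba.
  by rewrite -!eM bab.
by split; apply: inj; rewrite !eM !eV ?isgK ?isgVK.
Qed.

Lemma munn_mulP : munn_product munn_mul.
Proof.
split.
- by move=> a; rewrite /munn_mul isg0x // normal_form0.
- by move=> a; rewrite /munn_mul isgx0 // normal_form0.
move=> t1 t2 T1 T2 r1 g1 r2 g2 U nonzero.
have [h1 h2] := munn_elt_prod r1 g1 r2 g2; split=> [/h1[t [e tU tg]]|/h2 e].
  by exists t; split=> //; rewrite /munn_mul e munn_eltK.
by rewrite /munn_mul e normal_form0.
Qed.

Lemma munn_invP : munn_inverse munn_inv.
Proof.
split; first by rewrite /munn_inv isg_inv0 // normal_form0.
move=> t T r Tg; have [t' [e tT tg]] := munn_elt_invE r Tg.
by exists t'; split=> //; rewrite /munn_inv e munn_eltK.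
Qed.

Lemma omegaM p q : omega (path_mul p q) = (omega p * omega q)%g.
Proof.
apply: freegroup_inj; rewrite /= red_catl red_catr.
by rewrite red_id //; exact: red_reduced.
Qed.

Lemma omega_eq1 p : reduced p.2 -> omega p = 1%g -> p = vpath (path_src p).
Proof.
case: p => v w rw /(congr1 (@fg_word _)); rewrite /= red_id // => ->.
by [].
Qed.

(** A nontrivial word remembers its source, as the source of its first letter. *)
Lemma omega_inj p q : rpath p -> rpath q -> p <> vpath (path_src p) ->
  omega p = omega q -> p = q.
Proof.
case: p q => [v w] [u z] [iw rw] [iz rz] pv /(congr1 (@fg_word _)) /=.
rewrite !red_id // => e; subst z; congr pair.
by case: w iw iz pv {rw rz} => // x w [/= <- _] [/= <- _].
Qed.

Definition degree s : freegroup (edge E) := munn_omega (normal_form s).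

Lemma degree_munn_elt t : degree (munn_elt (Some t)) = omega (mt_end t).
Proof. by rewrite /degree munn_eltK. Qed.

Lemma degree_hom : partial_hom degree.
Proof.
move=> s s' ss'0.
have s0 : s <> 0 by move=> z; apply: ss'0; rewrite z isg0x.
have s'0 : s' <> 0 by move=> z; apply: ss'0; rewrite z isgx0.
have [t1 e1] := normal_form_neq0 s0; have [t2 e2] := normal_form_neq0 s'0.
have [T1 r1 g1] := representative_exists t1.
have [T2 r2 g2] := representative_exists t2.
have [h1 h2] := munn_elt_prod r1 g1 r2 g2.
rewrite -e1 -e2 !normal_formK in h1 h2.
have [/h1[t [e _ tg]]|/h2//] := pselect (path_tgt (mt_end t1) = mt_root t2 /\
    C_compatible (T1 `|` translate (mt_end t1) T2)).
by rewrite e degree_munn_elt /degree e1 e2 tg omegaM.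
Qed.

Lemma degree1 s : s <> 0 -> degree s = 1%g ->
  exists2 t, s = munn_elt (Some t) & mt_end t = vpath (mt_root t).
Proof.
move=> /normal_form_neq0[t e]; rewrite /degree e => /= o.
exists t; first by rewrite -[LHS](normal_formK s) e.
by apply: omega_eq1 => //; case: (mt_end_rpath t).
Qed.

Lemma degree_pure : idempotent_pure degree.
Proof.
move=> s s0; split=> [/(degree1 s0)[t -> /munn_elt_vpath ->]|ss].
  exact: tree_idem_idem.
have := @degree_hom s s; rewrite ss => /(_ s0) e.
by rewrite -[LHS](mulKg (degree s)) -e mulVg.
Qed.

Lemma Yidem_iso : idempotent_iso (@Yidem E).
Proof.
have Y0 : Yidem (sl_bot : Ylat E) = 0 by rewrite [LHS]Yidem_pi.
have YM (y z : Ylat E) : Yidem (sl_meet y z) = Yidem y * Yidem z.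
  by rewrite [LHS]Yidem_pi Xidem_meet.
split=> //; split.
- by move=> y _; have := YM y y; rewrite sl_meetxx => /esym.
- by move=> y z _ _; exact: Yidem_inj.
move=> s ss; have [->|s0] := pselect (s = 0); first by exists sl_bot.
have [t -> tv] := degree1 s0 (proj2 (degree_pure s0) ss).
exists (Yclass (mt_set t)) => //; rewrite munn_elt_vpath //.
by apply: (@Yidem_class _ (mt_root t)); case: (mt_setP t) => /inX_subtree.
Qed.

Definition tree_action := da_action SP degree_hom degree_pure Yidem_iso.

Lemma Yidem_inX v T : inX v T -> Yidem (Yclass T) = I T.
Proof. by move=> TX; exact: Yidem_class (inX_subtree TX). Qed.

Lemma munn_elt_ran t : munn_elt (Some t) * (munn_elt (Some t))^-1 = I (mt_set t).
Proof.
have [T r Tg] := representative_exists t; have [TX TT] := r.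
have sT := inX_subtree TX; have [Tf _ _ _] := sT.
rewrite (munn_elt_repr r) (isg_invM SP) (isg_inv_idem SP (tree_idem_idem _ SP _)).
rewrite isgA // -(isgA SP (I T)) -/(path_idem _ _) (tree_idem_absorb _ SP Tf Tg).
by rewrite (tree_idem_idem _ SP) -TT (tree_idem_low0 SP gR sT).
Qed.

Lemma tree_action_dom v g : FC v g -> g <> vpath v ->
  pa_dom tree_action (omega g) =
    [set Yclass T | T in [set T | inX0 v T /\ T (g0 g)]] `|` [set sl_bot].
Proof.
move=> [sg gv] gnv; have rg := sep_rpath sg.
apply/seteqP; split=> y.
  case=> [->|[s [s0 ds ys]]]; first by right.
  left; have [t e] := normal_form_neq0 s0.
  have es : s = munn_elt (Some t) by rewrite -e normal_formK.
  have gt : g = mt_end t.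
    apply: omega_inj => //; [exact: mt_end_rpath|by rewrite gv|].
    by rewrite -ds es degree_munn_elt.
  have [tX0 tg] := (mt_setP t, mt_in t); rewrite -gt gv in tX0 tg.
  exists (mt_set t) => //; apply: Yidem_inj.
  by rewrite (Yidem_inX (proj1 tX0)) ys es munn_elt_ran.
case=> [[T [TX Tg] <-]|->]; last by left.
right; rewrite -gv in TX; pose t := MunnTree TX sg Tg.
exists (munn_elt (Some t)); split; first exact: munn_elt_Some_neq0.
  exact: degree_munn_elt.
by rewrite munn_elt_ran (Yidem_inX (proj1 TX)).
Qed.

(** The element of degree [omega g] with domain [T] is the inverse of the Munn tree
    [(T, path_inv g)]. *)
Lemma tree_action_act v g T T' : FC v g ->
  inX0 (path_tgt g) T -> T (g0 (path_inv g)) ->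
  representative (path_tgt g) T T' -> T' (path_inv g) ->
  inX0 v (low0 (translate g T')) /\
  pa_act tree_action (omega g) (Yclass T) = Yclass (low0 (translate g T')).
Proof.
move=> [sg gv] TX Tg r T'g; have rg := sep_rpath sg.
have [_ _ _ [/(_ _ T'g)[sig _] _]] := proj1 r.
pose t := @MunnTree _ T (path_inv g) TX sig Tg.
have r' : representative (mt_root t) (mt_set t) T' by [].
have [t' [e tT tg]] := munn_elt_invE r' T'g.
rewrite /= (path_invK (proj1 rg)) in tT tg.
have t'X : inX0 v (low0 (translate g T')).
  by have := mt_setP t'; rewrite tT tg gv.
split=> //; apply: Yidem_inj; rewrite (Yidem_inX (proj1 t'X)) -tT -munn_elt_ran.
have [_ act] := da_determined SP degree_hom degree_pure Yidem_iso.
rewrite -(act _ (Yclass T) (@munn_elt_Some_neq0 _ t')).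
  by rewrite degree_munn_elt tg.
by rewrite -e isg_invK // munn_elt_ran (Yidem_inX (proj1 TX)).
Qed.

End NormalForm.

Theorem theorem4p5 (E : sepgraph) :
  (forall t : munn_tree E, exists2 T',
     representative (mt_root t) (mt_set t) T' & T' (mt_end t)) /\
  exists (mul : munn0 E -> munn0 E -> munn0 E) (inv : munn0 E -> munn0 E),
  [/\ munn_product mul, munn_inverse inv, inverse_semigroup0 (munn mul inv) &
  exists phi : SEC E -> munn mul inv,
    let pi : SEC E -> freegroup (edge E) := fun s => munn_omega (phi s) in
    [/\ isg0_iso phi, partial_hom pi, idempotent_pure pi &
    exists (psi : Ylat E -> SEC E)
           (theta : partial_action (freegroup (edge E)) (Ylat E)),
    [/\ idempotent_iso psi /\
        (forall t : munn_tree E, mt_end t = vpath (mt_root t) ->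
           phi (psi (Yclass (mt_set t))) = Some t),
        determined_action pi psi theta,
        semidirect_decomposition pi psi theta &
        forall (v : vertex E) (g : gpath E), FC v g -> g <> vpath v ->
          pa_dom theta (omega g) =
            [set Yclass T | T in [set T | inX0 v T /\ T (g0 g)]]
              `|` [set sl_bot] /\
          forall T T' : set (gpath E),
            inX0 (path_tgt g) T -> T (g0 (path_inv g)) ->
            representative (path_tgt g) T T' -> T' (path_inv g) ->
            inX0 v (low0 (translate g T')) /\
            pa_act theta (omega g) (Yclass T) =
              Yclass (low0 (translate g T'))]]].
Proof.
split; first exact: representative_exists.
exists (@munn_mul E), (@munn_inv E); split.
- exact: munn_mulP.
- exact: munn_invP.
- exact: munn_inverse_semigroup0.
exists (@normal_form E) => pi; split.
- exact: normal_form_iso.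
- exact: degree_hom.
- exact: degree_pure.
exists (@Yidem E), (tree_action E); split.
- split; first exact: Yidem_iso.
  move=> t tv; rewrite (Yidem_inX (proj1 (mt_setP t))) -munn_elt_vpath //.
  exact: munn_eltK.
- exact: da_determined.
- exact: da_semidirect.
move=> v g gF gv; split; first exact: tree_action_dom.
by move=> T T'; exact: tree_action_act.
Qed.
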